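(* Let $G$ be a binary critical Galton-Watson tree, that is, a Galton-Watson tree with offspring distribution $(\delta_0+\delta_2)/2$. Fix $n\ge1$ and let $G_n=\mathcal{P}_n(G)$ (all the random objects used by $\mathcal{P}_n$ being taken conditionally on $G$). (i) For all $k\ge1$, $\Pr[|L(G)|=k]=p_k$, where $p_k=\frac{2}{4^kk}\binom{2k-2}{k-1}$. (ii) For all $k\ge1$, $\Pr[|L(G_n)|=k]=p^n_k$, where $p^n_k=c^n_k/m_0(c^n)$ and $c^n=(c^n_k)_{k\ge1}$ is the unique solution to $(E_n)$.
   Context: For a $[0,\infty)$-valued sequence $u$ and $i\ge 0$, $m_i(u)=\sum_{k\ge1}k^iu_k$. For $n\in\mathbb{N}=\{1,2,\dots\}$, a sequence $c^n=(c^n_k)_{k\ge1}$ of nonnegative reals solves $(E_n)$ if $m_1(c^n)=1$ and, for all $k\ge2$, $\left(2+\frac{k-1}{n}\right)c^n_k=\frac{1}{m_0(c^n)}\sum_{i=1}^{k-1}c^n_ic^n_{k-i}$; it is known that there is exactly one solution. Trees. $T$ is a rooted discrete binary tree (each vertex has $0$ or $2$ children) with root $\emptyset$; one adds an extra vertex $\star$ and an edge joining $\star$ to $\emptyset$ (so $E(T)$ contains this edge). $L(T)$ is the set of leaves; $\star$ is not a leaf, but $\emptyset$ is a leaf iff the vertex set is $\{\star,\emptyset\}$. $N(T)$ is the set of internal nodes: all vertices other than $\star$ and the leaves. Pruning procedure $\mathcal{P}_n$ for a finite tree $T$. Step 1: endow each edge $e$ with a length $\kappa_e$, where the $\kappa_e$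 are i.i.d. exponential random variables with parameter $2$ (mean $1/2$). Step 2: conditionally on the lengths, for each $x\in N(T)$ let $\pi^n_x$ be a Poisson point process with rate $1/n$ (w.r.t. length) on the branch joining $x$ to $\star$, these processes being mutually independent. All marks of all these processes are initially active. Step 3: explore the tree from the top down to $\star$ (points in order of decreasing distance to $\star$); each time an active mark is encountered, remove the whole subtree above the mark, replace it by a leaf, and deactivate all the marks of the processes $\pi^n_x$ corresponding to nodes $x$ in the removed subtree. Step 4: the resulting tree, a subtree containing $\star$, is $\mathcal{P}_n(T)$. *)

(* Defs.v *)
From HB Require Import structures.
From mathcomp Require Import all_boot all_order all_algebra finmap.
From mathcomp Require Import all_classical all_reals all_analysis.

Set Implicit Arguments.
Unset Strict Implicit.
Unset Printing Implicit Defensive.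

Import Order.TTheory GRing.Theory Num.Theory.
Local Open Scope classical_set_scope.
Local Open Scope ring_scope.

(* The entry [u 0] is never used: sequences are indexed by k >= 1. *)
Definition moment (R : realType) (i : nat) (u : nat -> R) : \bar R :=
  (\sum_(1 <= k <oo) (k%:R ^+ i * u k)%:E)%E.

(* [moment 0 c <= moment 1 c = 1], so [fine] loses nothing. *)
Definition solves_E (R : realType) (n : nat) (c : nat -> R) : Prop :=
  [/\ forall k, (1 <= k)%N -> 0 <= c k,
      moment 1 c = 1%E &
      forall k, (2 <= k)%N ->
        (2 + (k - 1)%N%:R / n%:R) * c k =
        (fine (moment 0 c))^-1 * \sum_(1 <= i < k) c i * c (k - i)%N].

(* Ulam-Harris words: [[::]] is the root and [rcons u i] the i-th child of u.
   The extra vertex is left implicit: it is the parent of [[::]], so that u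
   also names the edge joining u to its parent, and the edges of T are in
   bijection with the elements of T. *)
Notation vertex := (seq nat).

Definition internal (T : set vertex) : set vertex :=
  [set u | T u /\ exists i, T (rcons u i)].

Definition leaves (T : set vertex) : set vertex :=
  [set u | T u /\ ~ exists i, T (rcons u i)].

(* The tree in which each vertex v has [off v] children. *)
Definition gw_tree (off : vertex -> nat) : set vertex :=
  [set u | forall v i, prefix (rcons v i) u -> (i < off v)%N].

(* Singletons s give the law mu of each xi v, larger s the independence. *)
Definition iid_offspring (d : measure_display) (Omega : measurableType d)
    (R : realType) (P : probability Omega R) (mu : nat -> R)
    (xi : vertex -> {RV P >-> nat}) : Prop :=
  forall (s : {fset vertex}) (k : vertex -> nat),
    (P (\bigcap_(v in [set` s]) (xi v @^-1` [set k v])) =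
     \prod_(v <- s) (mu (k v))%:E)%E.

Definition critical_binary (R : realType) (k : nat) : R :=
  ((k == 0%N)%:R + (k == 2%N)%:R) / 2.

Section Pruning.
Variables (R : realType) (kappa : vertex -> R).

(* Length of the branch joining x to the extra vertex. *)
Definition height (x : vertex) : R :=
  \sum_(i < (size x).+1) kappa (take i x).

(* The edge carrying the point at distance s from the extra vertex on the
   branch of x. *)
Definition edge_at (x : vertex) (s : R) : vertex :=
  take (find (fun i => s <= height (take i x)) (iota 0 (size x).+1)) x.

(* Cut on the edge below u: u becomes a leaf, its strict descendants go. *)
Definition cut (u : vertex) (T : set vertex) : set vertex :=
  [set v | T v /\ (prefix u v -> v = u)].

(* A mark (x, s) is the point at distance s from the extra vertex belonging to
   the process of the internal node x. It has been deactivated exactly when x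
   has been removed, that is when x is no longer an internal node of the
   current tree. *)
Definition explore_mark (T : set vertex) (m : vertex * R) : set vertex :=
  if `[< internal T m.1 >] then cut (edge_at m.1 m.2) T else T.

Definition marks (T : set vertex) (pi : vertex -> seq R) : seq (vertex * R) :=
  [seq (x, s) | x <- fset_set (internal T), s <- pi x].

(* Meaningful for finite T; an infinite T is returned unchanged, because
   [fset_set] of an infinite set is empty. *)
Definition pruned (pi : vertex -> seq R) (T : set vertex) : set vertex :=
  foldl explore_mark T (sort (fun a b => b.2 <= a.2) (marks T pi)).

End Pruning.

Section Randomness.
Variables (d : measure_display) (Omega : measurableType d) (R : realType)
  (P : probability Omega R).
Variables (n : nat) (G : Omega -> set vertex)
  (kappa : vertex -> {RV P >-> R}) (pi : vertex -> Omega -> seq R).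

Definition tree_event (T : set vertex) : set Omega := [set w | G w = T].

Definition sigma_lengths (T : set vertex) : set (set Omega) :=
  <<s [set F | exists (e : vertex) (B : set R),
         [/\ T e, measurable B & F = kappa e @^-1` B]] >>.

Definition nb_points (A : set R) (x : vertex) (w : Omega) : nat :=
  count (fun s => s \in A) (pi x w).

(* Mean number of points of A in a Poisson process of rate 1/n on the branch
   of x, which is identified with [0, height x]. *)
Definition intensity (A : set R) (x : vertex) (w : Omega) : R :=
  fine (lebesgue_measure (A `&` `[0, height (kappa ^~ w) x])) / n%:R.

(* Point processes are given by lists of their points. [marks_law] says that,
   conditionally on G = T and on the lengths of the edges of T, the processes
   of the internal nodes of T are independent Poisson processes: numbers of
   points in disjoint sets (or for distinct nodes) are independent Poisson
   variables. [poisson_prob] ignores its second argument; unlike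
   [poisson_pmf], it is the Dirac mass at 0 for a null rate. *)
Record pruning_randomness : Prop := PruningRandomness {
  lengths_law : forall (T : set vertex) (B : vertex -> set R),
    finite_set T -> (forall e, measurable (B e)) ->
    (P (tree_event T `&` \bigcap_(e in T) (kappa e @^-1` B e)) =
     P (tree_event T) * \prod_(e <- fset_set T) exponential_prob 2%R (B e))%E;
  nb_points_measurable : forall (A : set R) (x : vertex) (m : nat),
    measurable A -> measurable [set w | nb_points A x w = m];
  marks_law : forall (T : set vertex) (F : set Omega) (r : nat)
      (A : vertex -> 'I_r -> set R) (m : vertex -> 'I_r -> nat),
    finite_set T -> sigma_lengths T F ->
    (forall x i, measurable (A x i)) -> (forall x, trivIset setT (A x)) ->
    (P (tree_event T `&` F `&`
        \bigcap_(x in internal T) \bigcap_i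
          [set w | nb_points (A x i) x w = m x i]) =
     \int[P]_(w in tree_event T `&` F)
       \prod_(x <- fset_set (internal T)) \prod_(i < r)
         poisson_prob (intensity (A x i) x w) 0%N [set m x i])%E
}.

End Randomness.

(* Main.v *)
(** Let T be a finite binary tree and u one of its edges. Once the two
    subtrees above u have been pruned, leaving a tree S, the marks on u that
    are still active come from the internal nodes of S, so u stays uncut iff
    none of these nodes, |S| = #|L(S)| - 1 in number, has a mark on u. Given
    the length kappa_u this has probability exp (- |S| kappa_u / n); averaging
    over the exponential length gives 2 / (2 + |S| / n), and distinct edges
    are independent. Splitting G at its first branching, q_k = P (#|L(G_n)| =
    k) therefore satisfies (2 + (k - 1) / n) q_k = sum_i q_i q_(k-i) for k >=
    2, which is also the recursion of c / m_0(c). Both sequences have mass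
    one, and since the recursion is monotone in its first term, only one
    sequence can. For (i) the same recursion without marks is the Catalan
    recursion.

    Two points need care. The law of the marks is only given for deterministic
    sets, so the random slices of the branches are reached by discretising the
    lengths and passing to the limit. And the event in (ii) has to be
    measurable even where it is negligible: lengths <= 0, marks off their
    branch, ties between marks, infinite trees. *)

Require Import Defs.
From HB Require Import structures.
From mathcomp Require Import all_boot all_order all_algebra finmap.
From mathcomp Require Import all_classical all_reals all_analysis.
From mathcomp Require Import measurable_realfun ring lra zify.

Set Implicit Arguments.
Unset Strict Implicit.
Unset Printing Implicit Defensive.

Import Order.TTheory GRing.Theory Num.Theory.
Import numFieldNormedType.Exports.
Local Open Scope classical_set_scope.
Local Open Scope ring_scope.

(** * Finite binary trees *)

(** The process of a node crosses every edge of its branch, so the pruning of a subtree shares its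
    processes with all the edges below it. Independence is therefore organised by edges: the event
    that given nodes leave no mark on given edges has a conditional probability that factors over
    the edges. These avoidance events are stable under intersection but not under complement, and a
    cut edge is a complement. The induction on trees never computes a cut directly: it is stated for
    all events D independent of the edges concerned, and the outcome reduced to a leaf receives the
    mass left by the others.

    Sums over all finite trees are taken as limits over the trees of height at most h, for which
    splitting at the root relates h + 1 to h exactly. In the limit the probability e that G is
    finite satisfies e = 1/2 + e^2/2, and criticality makes 1 the double, hence only, root. *)

Lemma card_eq_seq (T : choiceType) (s : seq T) : uniq s ->
  ([set` s] #= `I_(size s))%card.
Proof.
move=> us; have -> : [set` s] = [set` [fset x in s]%fset].
  by apply/seteqP; split => x /=; rewrite inE.
by apply/card_eq_fsetP; rewrite card_fseq undup_id.
Qed.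

Inductive btree := Lf | Nd of btree & btree.

Fixpoint nodes (t : btree) : seq vertex :=
  if t is Nd l r
  then [::] :: [seq 0%N :: v | v <- nodes l] ++ [seq 1%N :: v | v <- nodes r]
  else [:: [::]].

Fixpoint inodes (t : btree) : seq vertex :=
  if t is Nd l r
  then [::] :: [seq 0%N :: v | v <- inodes l] ++ [seq 1%N :: v | v <- inodes r]
  else [::].

Fixpoint nleaves (t : btree) : nat :=
  if t is Nd l r then (nleaves l + nleaves r)%N else 1%N.

Definition tset (t : btree) : set vertex := [set` nodes t].

Lemma mem_map_cons (i j : nat) (v : vertex) (s : seq vertex) :
  (i :: v \in [seq j :: w | w <- s]) = (i == j) && (v \in s).
Proof.
apply/mapP/andP => [[w ws [-> ->]]|[/eqP-> vs]]; first by rewrite eqxx.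
by exists v.
Qed.

Lemma nil_notin_map_cons (j : nat) (s : seq vertex) :
  ([::] \in [seq j :: w | w <- s]) = false.
Proof. by apply/mapP => -[]. Qed.

Lemma mem_nodes_cons i v l r : (i :: v \in nodes (Nd l r)) =
  ((i == 0%N) && (v \in nodes l)) || ((i == 1%N) && (v \in nodes r)).
Proof. by rewrite /= inE mem_cat !mem_map_cons. Qed.

Lemma mem_inodes_cons i v l r : (i :: v \in inodes (Nd l r)) =
  ((i == 0%N) && (v \in inodes l)) || ((i == 1%N) && (v \in inodes r)).
Proof. by rewrite /= inE mem_cat !mem_map_cons. Qed.

Lemma nil_nodes t : [::] \in nodes t.
Proof. by case: t. Qed.

Lemma cons_injective (i : nat) : injective (cons i).
Proof. by move=> u v []. Qed.

Lemma uniq_cons_cons (s1 s2 : seq vertex) : uniq s1 -> uniq s2 ->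
  uniq ([::] :: [seq 0%N :: v | v <- s1] ++ [seq 1%N :: v | v <- s2]).
Proof.
move=> u1 u2; rewrite /= mem_cat !nil_notin_map_cons/= cat_uniq.
rewrite !map_inj_uniq ?u1 ?u2 ?andbT//=; try exact: cons_injective.
by apply/hasPn => -[|i v]; rewrite ?nil_notin_map_cons// !mem_map_cons => /andP[/eqP->].
Qed.

Lemma nodes_uniq t : uniq (nodes t).
Proof. by elim: t => // l ul r ur; exact: uniq_cons_cons. Qed.

Lemma inodes_uniq t : uniq (inodes t).
Proof. by elim: t => // l ul r ur; exact: uniq_cons_cons. Qed.

Lemma nleaves_gt0 t : (0 < nleaves t)%N.
Proof. by elim: t => //= l l0 r r0; rewrite addn_gt0 l0. Qed.

Lemma size_inodes t : size (inodes t) = (nleaves t).-1.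
Proof.
elim: t => //= l IHl r IHr; rewrite size_cat !size_map IHl IHr.
by have := nleaves_gt0 l; have := nleaves_gt0 r; lia.
Qed.

Lemma inodes_nodes t x : x \in inodes t -> x \in nodes t.
Proof.
elim: t x => // l IHl r IHr [|i x]; first by rewrite nil_nodes.
rewrite mem_inodes_cons mem_nodes_cons.
by case/orP => /andP[/eqP->] /=; [move/IHl|move/IHr] => ->; rewrite ?orbT.
Qed.

Lemma take_nodes t x i : x \in nodes t -> take i x \in nodes t.
Proof.
elim: t x i => [|l IHl r IHr] [|j x] [|i]; rewrite ?nil_nodes//.
by rewrite take_cons !mem_nodes_cons; case/orP => /andP[-> /=];
  [move/IHl|move/IHr] => ->; rewrite ?orbT.
Qed.

(** Defined on arbitrary sets: the states passed through by an exploration then need not be shown to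
    be trees. *)
Definition join (A B : set vertex) : set vertex := fun v =>
  if v is i :: v' then i = 0%N /\ A v' \/ i = 1%N /\ B v' else True.

Lemma tset_Nd l r : tset (Nd l r) = join (tset l) (tset r).
Proof.
apply/funext => -[|i v]; apply/propext; split => //.
  by rewrite -[tset _ _]/(is_true (_ \in _)) mem_nodes_cons =>
    /orP[]/andP[/eqP-> ?]; [left|right].
rewrite -[tset _ _]/(is_true (_ \in _)) mem_nodes_cons.
by move=> [[-> vl]|[-> vr]]; apply/orP; [left|right].
Qed.

Lemma internal_join_cons A B i x : internal (join A B) (i :: x) <->
  i = 0%N /\ internal A x \/ i = 1%N /\ internal B x.
Proof.
split.
  move=> [/= [[-> Ax]|[-> Bx]]] [j [[// _ ?]|[// _ ?]]].
    by left; split=> //; split => //; exists j.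
  by right; split=> //; split => //; exists j.
move=> [[-> [Ax [j Aj]]]|[-> [Bx [j Bj]]]]; split => /=; [by left| |by right|].
  by exists j; left.
by exists j; right.
Qed.

Lemma internal_tset t x : internal (tset t) x <-> x \in inodes t.
Proof.
elim: t x => [|l IHl r IHr] x.
  by split => // -[_ [i]]; case: x.
rewrite tset_Nd; case: x => [|i x].
  split => // _; split => //; exists 0%N; left; split => //=.
  exact: nil_nodes.
rewrite internal_join_cons IHl IHr mem_inodes_cons.
split=> [[[-> ->]|[-> ->]]|/orP[]/andP[/eqP-> ->]]; rewrite ?orbT//; by auto.
Qed.

Lemma leaves_join_cons A B i x : leaves (join A B) (i :: x) <->
  i = 0%N /\ leaves A x \/ i = 1%N /\ leaves B x.
Proof.
split.
  move=> [/= [[-> Ax]|[-> Bx]] nch]; [left|right]; split => //; split => //;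
  by move=> [j ?]; apply: nch; exists j; rewrite /= ; by auto.
move=> [[-> [Ax nA]]|[-> [Bx nB]]].
  by split; [left|move=> [j [[_ ?]|[]//]]; apply: nA; exists j].
by split; [right|move=> [j [[]//|[_ ?]]]; apply: nB; exists j].
Qed.

Lemma leaves_tset_ex t : exists s : seq vertex,
  [/\ uniq s, size s = nleaves t & leaves (tset t) = [set` s]].
Proof.
elim: t => [|l [s1 [u1 z1 e1]] r [s2 [u2 z2 e2]]].
  exists [:: [::]]; split => //; apply/seteqP; split => x /=; first by case.
  by rewrite inE => /eqP->; split => //; case.
exists ([seq 0%N :: v | v <- s1] ++ [seq 1%N :: v | v <- s2]); split.
- by have := uniq_cons_cons u1 u2; rewrite /= => /andP[].
- by rewrite size_cat !size_map z1 z2.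
- apply/funext => -[|i x]; apply/propext; rewrite tset_Nd.
    rewrite /= mem_cat !nil_notin_map_cons; split => // -[_ []].
    by exists 0%N; left; split => //=; exact: nil_nodes.
  rewrite leaves_join_cons e1 e2 /= mem_cat !mem_map_cons.
  by split=> [[[-> ->]|[-> ->]]|/orP[]/andP[/eqP-> ->]]; rewrite ?orbT//; auto.
Qed.

Lemma leaves_tset t k : (leaves (tset t) #= `I_k)%card <-> nleaves t = k.
Proof.
have [s [us <- ->]] := leaves_tset_ex t.
have sE := card_eq_seq us.
split=> [e|<-//]; apply/card_eq_II.
by apply: card_eq_trans e; rewrite card_eq_sym.
Qed.

(** Makes the events [tree_event G (tset t)] pairwise disjoint, as the sums over trees require. *)
Lemma tset_inj : injective tset.
Proof.
have LfNd l r : tset Lf <> tset (Nd l r).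
  move=> e; have : [:: 0%N] \in nodes (Nd l r).
    by rewrite mem_nodes_cons nil_nodes.
  by rewrite -[is_true _]/(tset (Nd l r) [:: 0%N]) -e /tset/= inE.
have sub0 l r l' r' : tset (Nd l r) = tset (Nd l' r') ->
    tset l `<=` tset l' /\ tset r `<=` tset r'.
  rewrite !tset_Nd => e; split=> v vl.
    have : join (tset l) (tset r) (0%N :: v) by left.
    by rewrite e => -[[]|[]].
  have : join (tset l) (tset r) (1%N :: v) by right.
  by rewrite e => -[[]|[]].
elim=> [|l IHl r IHr] [|l' r'] //; [by move=> /LfNd|by move=> /esym/LfNd|].
move=> e; have [ll rr] := sub0 _ _ _ _ e; have [ll' rr'] := sub0 _ _ _ _ (esym e).
by congr Nd; [apply: IHl|apply: IHr]; apply/seteqP.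
Qed.

(** * Pruning as a structural recursion *)

(* [b x] says that the internal node x has no mark on the root edge. *)
Definition prune_root (b : vertex -> bool) (t : btree) : btree :=
  if all b (inodes t) then t else Lf.

(* [B x u] says that the internal node x has no mark on the edge u. *)
Fixpoint rprune (t : btree) (B : vertex -> vertex -> bool) : btree :=
  if t is Nd l r then
    prune_root (B ^~ [::])
      (Nd (rprune l (fun x u => B (0%N :: x) (0%N :: u)))
          (rprune r (fun x u => B (1%N :: x) (1%N :: u))))
  else Lf.

Lemma inodes_rprune t B x : x \in inodes (rprune t B) -> x \in inodes t.
Proof.
elim: t B x => // l IHl r IHr B x; rewrite [rprune _ _]/= /prune_root;
  case: ifP => // _.
case: x => [//|i x]; rewrite !mem_inodes_cons.
by case/orP => /andP[-> /=]; [move/IHl|move/IHr] => ->; rewrite ?orbT.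
Qed.

(** The recursion tests [B x u] only for x above u. This is what allows [unmarked] to be replaced by
    [unhit], compared only along the branch of x. *)
Lemma eq_rprune t B B' :
  (forall x u, x \in inodes t -> u \in nodes t -> prefix u x ->
    B x u = B' x u) ->
  rprune t B = rprune t B'.
Proof.
elim: t B B' => // l IHl r IHr B B' BB'; rewrite [LHS]/= [RHS]/=.
have -> : rprune l (fun x u => B (0%N :: x) (0%N :: u)) =
          rprune l (fun x u => B' (0%N :: x) (0%N :: u)).
  apply: IHl => x u xl ul ux; apply: BB'; last by rewrite /= ux.
    by rewrite mem_inodes_cons xl.
  by rewrite mem_nodes_cons ul.
have -> : rprune r (fun x u => B (1%N :: x) (1%N :: u)) =
          rprune r (fun x u => B' (1%N :: x) (1%N :: u)).
  apply: IHr => x u xl ul ux; apply: BB'; last by rewrite /= ux.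
    by rewrite mem_inodes_cons xl.
  by rewrite mem_nodes_cons ul.
rewrite /prune_root; set s := Nd _ _; congr (if _ then _ else _).
apply: eq_in_all => x xs; apply: BB'; [|exact: nil_nodes|exact: prefix0s].
case: x xs => [//|i x]; rewrite !mem_inodes_cons.
by case/orP => /andP[-> /=] /inodes_rprune ->; rewrite ?orbT.
Qed.

(** * Exploration of the marks by decreasing distance *)

Section explore.
Context (R : realType).
Implicit Types (kappa : vertex -> R) (x u v : vertex) (M : seq (vertex * R)).

Lemma height_nil kappa : height kappa [::] = kappa [::].
Proof. by rewrite /height big_ord1. Qed.

Lemma height_cons kappa i x :
  height kappa (i :: x) = kappa [::] + height (fun v => kappa (i :: v)) x.
Proof. by rewrite /height big_ord_recl. Qed.

Lemma edge_at_root kappa x s : s <= kappa [::] -> edge_at kappa x s = [::].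
Proof. by move=> sk; rewrite /edge_at /= take0 height_nil sk take0. Qed.

Lemma edge_at_cons kappa i x s : kappa [::] < s ->
  edge_at kappa (i :: x) s =
  i :: edge_at (fun v => kappa (i :: v)) x (s - kappa [::]).
Proof.
move=> ks; rewrite /edge_at.
have -> : iota 0 (size (i :: x)).+1 = 0%N :: map succn (iota 0 (size x).+1).
  by rewrite -[iota 0 _]/(0%N :: iota (1 + 0) (size x).+1) iotaDl.
set F := find _ _; have -> : F = (find (fun j => s - kappa [::] <=
    height (fun v => kappa (i :: v)) (take j x)) (iota 0 (size x).+1)).+1.
  have find_cons p a (l : seq nat) :
    find p (a :: l) = if p a then 0%N else (find p l).+1 by [].
  rewrite /F find_cons take0 height_nil leNgt ks find_map; congr S.
  apply: eq_find => j.
  by rewrite -[LHS]/(s <= height kappa (i :: take j x)) height_cons lerBlDl.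
by [].
Qed.

(** Marks of the i-th subtree as seen from that subtree: the root takes over the part of the extra
    vertex, so distances drop by the length of the root edge. *)
Definition submarks kappa (i : nat) M : seq (vertex * R) :=
  [seq (behead m.1, m.2 - kappa [::]) | m <- M & (m.1 != [::]) && (head 0%N m.1 == i)].

Lemma cut_join_cons i u (A B : set vertex) : Defs.cut (i :: u) (join A B) =
  join (if i == 0%N then Defs.cut u A else A) (if i == 1%N then Defs.cut u B else B).
Proof.
apply/funext => -[|j v]; apply/propext; first by split.
have [E1 E2] : (prefix (i :: u) (j :: v) -> j :: v = i :: u) <->
    (i = j -> prefix u v -> v = u).
  rewrite /= ; split=> [H ij uv|H /andP[/eqP ij uv]]; last by rewrite H// ij.
  by have [] : j :: v = i :: u by apply: H; rewrite ij eqxx.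
split.
  move=> [[[j0 Av]|[j1 Bv]] /E1 H]; [left|right]; split => //; case: eqP => // i0;
  by split => //; apply: H; rewrite i0.
move=> [[j0]|[j1]]; case: eqP => ij H.
- case: H => Av H; split; [by left|by apply: E2 => _; exact: H].
- by split; [left|apply: E2; rewrite j0 => /ij].
- case: H => Bv H; split; [by right|by apply: E2 => _; exact: H].
- by split; [right|apply: E2; rewrite j1 => /ij].
Qed.

Lemma explore_join kappa A B i x s : kappa [::] < s -> (i < 2)%N ->
  explore_mark kappa (join A B) (i :: x, s) =
  join (if i == 0%N then explore_mark (fun v =>
    kappa (0%N :: v)) A (x, s - kappa [::]) else A)
       (if i == 1%N then explore_mark (fun v =>
         kappa (1%N :: v)) B (x, s - kappa [::]) else B).
Proof.
move=> ks i2; rewrite /explore_mark/= edge_at_cons// cut_join_cons.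
have -> : `[< internal (join A B) (i :: x) >] =
  ((i == 0%N) && `[< internal A x >]) || ((i == 1%N) && `[< internal B x >]).
  apply/asboolP/orP; rewrite internal_join_cons.
    by move=> [[-> ?]|[-> ?]]; [left|right]; apply/andP; split => //; apply/asboolP.
  by move=> [/andP[/eqP-> /asboolP]|/andP[/eqP-> /asboolP]]; auto.
by case: i i2 => [|[|]]//= _; rewrite ?orbF; case: ifP.
Qed.

(** The marks of the two subtrees are interleaved in M, but each one is tested and acts on its own
    side only, so the exploration splits into two separate ones. *)
Lemma foldl_explore_join kappa M A B :
  (forall m, m \in M -> exists i x, [/\ m.1 = i :: x, (i < 2)%N & kappa [::] < m.2]) ->
  foldl (explore_mark kappa) (join A B) M =
  join (foldl (explore_mark (fun v => kappa (0%N :: v))) A (submarks kappa 0 M))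
       (foldl (explore_mark (fun v => kappa (1%N :: v))) B (submarks kappa 1 M)).
Proof.
elim: M A B => // -[y s] M IHM A B H.
have [i [x [/= yE i2 ks]]] := H _ (mem_head _ _).
rewrite [LHS]/= yE explore_join// IHM; last first.
  by move=> m mM; apply: H; rewrite in_cons mM orbT.
by rewrite {1}/submarks /=; case: i i2 {yE} => [|[|]].
Qed.

Lemma cut_nil_tset t : Defs.cut [::] (tset t) = tset Lf.
Proof.
apply/seteqP; split=> v.
  by move=> [_ /(_ (prefix0s v)) ->]; exact: nil_nodes.
by rewrite /tset/= inE => /eqP->; split => //; exact: nil_nodes.
Qed.

Lemma foldl_explore_Lf kappa M : foldl (explore_mark kappa) (tset Lf) M = tset Lf.
Proof.
elim: M => //= m M IHM; rewrite {2}/explore_mark; case: asboolP => //.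
by rewrite internal_tset.
Qed.

(** On the root edge the order is immaterial: the first mark whose node is internal reduces the tree
    to a leaf, where no later mark is active. *)
Lemma foldl_explore_root kappa M t :
  (forall m, m \in M -> m.2 <= kappa [::]) ->
  foldl (explore_mark kappa) (tset t) M =
  tset (prune_root (fun x => ~~ has (fun m => m.1 == x) M) t).
Proof.
elim: M => [|m M IHM] H; first by rewrite /prune_root all_predT.
rewrite [foldl _ _ _]/= {2}/explore_mark edge_at_root ?H ?mem_head// cut_nil_tset.
have H' m' : m' \in M -> m'.2 <= kappa [::].
  by move=> mM; apply: H; rewrite in_cons mM orbT.
case: asboolP; rewrite internal_tset => mt.
  rewrite foldl_explore_Lf /prune_root; case: ifP => // /allP/(_ _ mt)/=.
  by rewrite eqxx.
rewrite IHM// /prune_root; congr (tset (if _ then _ else _)).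
apply: eq_in_all => x xt /=.
by case: eqP => // xm; rewrite xm xt in mt.
Qed.

Definition unmarked kappa M : vertex -> vertex -> bool := fun x u =>
  ~~ has (fun m => (m.1 == x) && (edge_at kappa m.1 m.2 == u)) M.

Lemma mem_submarks kappa i M m : m \in submarks kappa i M ->
  exists2 s, (i :: m.1, s) \in M & m.2 = s - kappa [::].
Proof.
move=> /mapP[[[|j x] s]]; rewrite mem_filter//= => /andP[/eqP-> xs] ->.
by exists s.
Qed.

Lemma submarksP kappa i M x s : (i :: x, s) \in M ->
  (x, s - kappa [::]) \in submarks kappa i M.
Proof. by move=> xs; apply/mapP; exists (i :: x, s); rewrite // mem_filter/= eqxx. Qed.

Lemma desc_trans : transitive (fun a b : vertex * R => b.2 <= a.2).
Proof. by move=> b a c /= ba cb; exact: le_trans cb ba. Qed.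

Lemma sorted_submarks kappa i M :
  sorted (fun a b : vertex * R => b.2 <= a.2) M ->
  sorted (fun a b : vertex * R => b.2 <= a.2) (submarks kappa i M).
Proof.
move=> sM; rewrite sorted_map.
apply: (@sub_sorted _ (fun a b : vertex * R => b.2 <= a.2)).
  by move=> a b /= ab; rewrite lerD2r.
by apply: sorted_filter => //; exact: desc_trans.
Qed.

Lemma edge_at_consP kappa i x s u :
  (edge_at kappa (i :: x) s == i :: u) =
  (kappa [::] < s) && (edge_at (fun v => kappa (i :: v)) x (s - kappa [::]) == u).
Proof.
case: (ltP (kappa [::]) s) => [ks|sk]; last by rewrite edge_at_root.
by rewrite edge_at_cons// eqseq_cons eqxx.
Qed.

Lemma unmarked_submarks kappa i M x u :
  unmarked (fun v => kappa (i :: v))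
    (submarks kappa i [seq m <- M | kappa [::] < m.2]) x u =
  unmarked kappa M (i :: x) (i :: u).
Proof.
congr negb; apply/hasP/hasP => [[m]|[[y s] mM]].
  move=> /mem_submarks[s]; rewrite mem_filter => /andP[/= ks xsM] mE.
  move=> /andP[/eqP <- /eqP <-]; exists (i :: m.1, s) => //=.
  by rewrite eqxx edge_at_consP ks mE/=.
move=> /andP[/eqP/= xE]; rewrite xE in mM *; rewrite edge_at_consP => /andP[ks ux].
exists (x, s - kappa [::]); last by rewrite /= eqxx.
by apply: submarksP; rewrite mem_filter/= ks.
Qed.

(** Decreasing distance explores every mark above the root edge ([M1]) before any mark on it ([M2]).
    When the root edge is reached both subtrees have their final form, so whether it is cut is
    decided by the internal nodes that survived, as in [rprune]. *)
Lemma foldl_explore kappa M t :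
  sorted (fun a b : vertex * R => b.2 <= a.2) M ->
  (forall m, m \in M -> m.1 \in inodes t /\ m.2 <= height kappa m.1) ->
  foldl (explore_mark kappa) (tset t) M = tset (rprune t (unmarked kappa M)).
Proof.
elim: t kappa M => [|l IHl r IHr] kappa M sM HM.
  by case: M {sM} HM => // m M /(_ m (mem_head _ _)) [].
pose p (m : vertex * R) := kappa [::] < m.2.
pose M1 := [seq m <- M | p m]; pose M2 := [seq m <- M | ~~ p m].
have ME : M = M1 ++ M2.
  rewrite /M1 /M2; elim: M sM {HM M1 M2} => //= m M IHM sM.
  have sM' := path_sorted sM.
  case: ifP => /= pm; first by rewrite -IHM.
  have mM m' : m' \in M -> p m' = false.
    have /allP H := order_path_min desc_trans sM.
    by move=> /H/= m'm; rewrite /p; apply/negbTE;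
      rewrite -leNgt (le_trans m'm)// leNgt; apply/negbT.
  have -> : [seq m <- M | p m] = [::].
    by apply/eqP; rewrite -(negbK (_ == _)) -has_filter; apply/hasPn => m' /mM->.
  by congr (_ :: _); apply/esym/all_filterP/allP => m' /mM ->.
have M1P m : m \in M1 ->
    exists i x, [/\ m.1 = i :: x, (i < 2)%N & kappa [::] < m.2].
  rewrite mem_filter => /andP[pm /HM[]]; rewrite /p in pm.
  case: m pm => -[|i x] s /= pm.
    by move=> _; rewrite height_nil leNgt pm.
  rewrite -[X in X -> _]/(is_true (i :: x \in inodes (Nd l r)))
    mem_inodes_cons => ixlr _.
  by exists i, x; split => //; case/orP: ixlr => /andP[/eqP->].
rewrite {1}ME foldl_cat tset_Nd foldl_explore_join//.
have sM1 : sorted (fun a b : vertex * R => b.2 <= a.2) M1.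
  by apply: sorted_filter => //; exact: desc_trans.
have inM1 i s x : (i :: x, s) \in M1 ->
    ((i == 0%N) && (x \in inodes l)) || ((i == 1%N) && (x \in inodes r)) /\
    s - kappa [::] <= height (fun v => kappa (i :: v)) x.
  rewrite mem_filter => /andP[pm /HM[]/=]; rewrite height_cons lerBlDl => + ->.
  by rewrite -[X in X -> _]/(is_true (i :: x \in inodes (Nd l r))) mem_inodes_cons.
rewrite IHl; last 2 first.
- exact: sorted_submarks.
- by move=> m /mem_submarks[s /inM1[/orP[/andP[]|//] _ ml] sk ->].
rewrite IHr; last 2 first.
- exact: sorted_submarks.
- by move=> m /mem_submarks[s /inM1[/orP[//|/andP[] _ ml]] sk ->].
rewrite -tset_Nd foldl_explore_root; last first.
  by move=> m; rewrite mem_filter => /andP[]; rewrite /p -leNgt.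
congr tset; rewrite [RHS]/=.
rewrite (@eq_rprune l _ (fun x u => unmarked kappa M (0%N :: x) (0%N :: u)));
  last first.
  by move=> x u _ _ _; exact: unmarked_submarks.
rewrite (@eq_rprune r _ (fun x u => unmarked kappa M (1%N :: x) (1%N :: u)));
  last first.
  by move=> x u _ _ _; exact: unmarked_submarks.
rewrite /prune_root; congr (if _ then _ else _); apply: eq_all => x.
congr negb; apply/hasP/hasP => [[m]|[m mM /andP[/eqP <- /eqP mk]]].
  rewrite mem_filter /p -leNgt => /andP[ms mM] /eqP <-.
  by exists m => //; rewrite eqxx edge_at_root//=.
exists m => //; rewrite mem_filter mM andbT; apply/negP => pm.
have [|i [y [my _ _]]] := M1P m; first by rewrite mem_filter pm.
by move: mk; rewrite my edge_at_cons.
Qed.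

(** Height of the lower end of the edge u, which occupies the slice []hpar u, height u]] of every
    branch through it. *)
Definition hpar kappa u : R := \sum_(i < size u) kappa (take i u).

Lemma heightE kappa u : height kappa u = hpar kappa u + kappa u.
Proof. by rewrite /height big_ord_recr/= take_size. Qed.

Lemma hpar_cons kappa i u :
  hpar kappa (i :: u) = kappa [::] + hpar (fun v => kappa (i :: v)) u.
Proof. by rewrite /hpar big_ord_recl. Qed.

(** [edge_at] finds the first edge whose upper end reaches s. With positive lengths the slices
    follow one another along the branch, so this is the one containing s; the root slice is open at
    0, hence [0 < s]. *)
Lemma edge_atE kappa x s u : (forall j, 0 < kappa (take j x)) ->
  0 < s -> s <= height kappa x -> prefix u x ->
  (edge_at kappa x s == u) = (hpar kappa u < s <= height kappa u).
Proof.
elim: x kappa s u => [|i x IHx] kappa s u k0 s0 sx.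
  rewrite height_nil in sx; rewrite prefixs0 => /eqP ->.
  by rewrite edge_at_root// height_nil sx eqxx /hpar big_ord0 s0.
case: u => [_|j u].
  rewrite height_nil /hpar big_ord0 s0/=; case: (leP s (kappa [::])) => sk.
    by rewrite edge_at_root// eqxx.
  by rewrite edge_at_cons.
rewrite [prefix _ _]/= => /andP[/eqP -> ux];
  rewrite edge_at_consP hpar_cons height_cons.
have k0' j' : 0 < kappa (i :: take j' x) by exact: (k0 j'.+1).
case: (ltP (kappa [::]) s) => [ks|sk]/=.
  have sx' : s - kappa [::] <= height (fun v => kappa (i :: v)) x.
    by rewrite lerBlDl -(height_cons kappa i).
  by rewrite IHx// ?subr_gt0// ltrBrDl lerBlDl.
apply/esym/negbTE; rewrite negb_and -leNgt; apply/orP; left.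
apply: (le_trans sk); rewrite lerDl; apply: sumr_ge0 => l _.
have uE : take (size u) x = u by apply/eqP; move: ux; rewrite prefixE.
by rewrite -[X in take l X]uE -take_min; exact/ltW.
Qed.

(** The question of [unmarked], asked with an interval instead of [edge_at]: it says that a number
    of points vanishes, which is what [marks_law] is about. *)
Definition unhit kappa (pi : vertex -> seq R) : vertex -> vertex -> bool :=
  fun x u => ~~ has (fun s => hpar kappa u < s <= height kappa u) (pi x).

Lemma pruned_tset kappa pi t :
  (forall e, e \in nodes t -> 0 < kappa e) ->
  (forall x, x \in inodes t -> all (fun s => 0 < s <= height kappa x) (pi x)) ->
  pruned kappa pi (tset t) = tset (rprune t (unhit kappa pi)).
Proof.
move=> k0 pi0; rewrite /pruned; set M := sort _ _.
have MP x s : ((x, s) \in M) = (x \in inodes t) && (s \in pi x).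
  rewrite mem_sort; apply/allpairsPdep/andP => [[y [s' [+ + [-> ->]]]]|[xt spi]].
    rewrite in_fset_set; last first.
      by apply: (@sub_finite_set _ _ [set` inodes t]) => // z /internal_tset.
    by rewrite inE => /internal_tset.
  exists x, s; split => //; rewrite in_fset_set ?inE; first exact/internal_tset.
  by apply: (@sub_finite_set _ _ [set` inodes t]) => // z /internal_tset.
rewrite foldl_explore; first last.
- by move=> [x s]; rewrite MP => /andP[xt /(allP (pi0 _ xt))/andP[_ sh]].
- by apply: sort_sorted => a b; exact: le_total.
congr tset; apply: eq_rprune => x u xt _ ux; congr negb.
have edge s : s \in pi x ->
    (edge_at kappa x s == u) = (hpar kappa u < s <= height kappa u).
  move=> /(allP (pi0 _ xt))/andP[s0 sh]; apply: edge_atE => // j.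
  by apply: k0; apply: take_nodes; exact: inodes_nodes.
apply/hasP/hasP => [[[y s]]|[s spi us]].
  by rewrite MP => /andP[yt spi] /andP[/eqP/= yx]; subst y; exists s; rewrite -?edge.
by exists (x, s); rewrite ?MP ?xt//= eqxx edge.
Qed.

End explore.

(** * Integrals of functions of a random variable *)

Section integral_mul_comp.
Local Open Scope ereal_scope.
Context d1 d2 (X : measurableType d1) (Y : measurableType d2) (R : realType).
Variables (mu : {measure set X -> \bar R}) (nu : {measure set Y -> \bar R}).
Variables (D : set X) (mD : measurable D) (f : X -> Y) (psi : X -> R) (C : R).
Hypotheses (mf : measurable_fun setT f) (mpsi : measurable_fun setT psi).
Hypothesis psi0 : forall x, (0 <= psi x)%R.
Hypothesis nuE : forall B, measurable B ->
  \int[mu]_(x in D `&` f @^-1` B) (psi x)%:E = C%:E * nu B.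

Import HBNNSimple.

Let mfB B : measurable B -> measurable (f @^-1` B).
Proof. by move=> mB; rewrite -[X in measurable X]setTI; exact: mf. Qed.

Let integral_mul_nnsfun (h : {nnsfun Y >-> R}) :
  \int[mu]_(x in D) (psi x * h (f x))%:E = C%:E * \int[nu]_y (h y)%:E.
Proof.
have ind r x : \1_(f @^-1` (h @^-1` [set r])) x = \1_(h @^-1` [set r]) (f x) :> R.
  by rewrite !indicE; congr (_%:R); apply/idP/idP; rewrite !inE.
pose I r (x : X) : R := (psi x * \1_(f @^-1` (h @^-1` [set r])) x)%R.
have mI r : measurable_fun D (EFin \o I r).
  apply: measurable_funTS; apply/measurable_EFinP; apply: measurable_funM => //.
  by apply: measurable_indic; exact: mfB.
transitivity (\int[mu]_(x in D)
    \sum_(r \in range h) (r%:E * (I r x)%:E)).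
  apply: eq_integral => x _.
  under eq_fsbigr do rewrite -EFinM.
  rewrite fsumEFin//; congr EFin.
  rewrite [in LHS]fimfunE mulrC mulr_fsuml; apply: eq_fsbigr => r _.
  by rewrite /I ind -mulrA (mulrC (psi x)).
rewrite ge0_integral_fsum//; last 2 first.
- by move=> r; exact: (measurable_funeM _ (mI r)).
- move=> r x _; rewrite /I ind -EFinM mulrCA EFinM.
  by rewrite mule_ge0 ?lee_fin// -lee_fin EFinM nnfun_muleindic_ge0.
rewrite integralT_nnsfun sintegralE ge0_mule_fsumr; last first.
  by move=> r; exact: nnsfun_mulemu_ge0.
apply: eq_fsbigr => r; rewrite inE => -[y _ yr].
have r0 : (0 <= r)%R by rewrite -yr.
rewrite ge0_integralZl//; last 2 first.
- exact: mI.
- by move=> x _; rewrite lee_fin mulr_ge0// indicE.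
rewrite muleCA; congr (_ * _); rewrite -nuE// integral_mkcondr.
apply: eq_integral => x _; rewrite patchE /I indicE; case: ifPn => _.
  by rewrite mulr1.
by rewrite mulr0.
Qed.

(** By [nuE], f sends the measure psi.mu on D to C.nu. Linearity extends this from sets to simple
    functions, and monotone convergence to phi. It serves once with psi a density and once with psi
    a product of functions of the other lengths. *)
Lemma integral_mul_comp (phi : Y -> \bar R) : measurable_fun setT phi ->
  (forall y, 0 <= phi y) ->
  \int[mu]_(x in D) ((psi x)%:E * phi (f x)) = C%:E * \int[nu]_y phi y.
Proof.
move=> mphi phi0; pose h := nnsfun_approx measurableT mphi.
have hphi y : (h n y)%:E @[n --> \oo] --> phi y by apply: cvg_nnsfun_approx.
have -> : \int[nu]_y phi y = limn (fun n => \int[nu]_y (h n y)%:E).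
  rewrite -monotone_convergence//.
  - by apply: eq_integral => y _; apply/esym/cvg_lim => //; exact: hphi.
  - by move=> n; exact/measurable_EFinP.
  - by move=> n y _; rewrite lee_fin.
  - by move=> y _ m n mn; rewrite lee_fin; exact/lefP/nd_nnsfun_approx.
have -> : \int[mu]_(x in D) ((psi x)%:E * phi (f x)) =
    limn (fun n => \int[mu]_(x in D) (psi x * h n (f x))%:E).
  rewrite -monotone_convergence//.
  - apply: eq_integral => x _; apply/esym/cvg_lim => //.
    by under eq_fun do rewrite EFinM; apply: cvgeZl => //; exact: hphi.
  - move=> n; apply: measurable_funTS; apply/measurable_EFinP.
    by apply: measurable_funM => //; exact: measurableT_comp.
  - by move=> n x _; rewrite lee_fin mulr_ge0.
  - move=> x _ m n mn; rewrite lee_fin ler_wpM2l//.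
    exact/lefP/nd_nnsfun_approx.
rewrite -limeMl//; last first.
  apply: ereal_nondecreasing_is_cvgn => m n mn; apply: ge0_le_integral => //.
  - by move=> y _; rewrite lee_fin.
  - exact/measurable_EFinP.
  - exact/measurable_EFinP.
  - by move=> y _; rewrite lee_fin; exact/lefP/nd_nnsfun_approx.
by congr (limn _); apply/funext => n; exact: integral_mul_nnsfun.
Qed.

End integral_mul_comp.

(** * Independent exponential lengths *)

Section exponential_laplace.
Context (R : realType).

(* [exponential_prob] is a probability only for positive rates: its instance
   takes a proof of positivity, which unification does not find. *)
Definition exponential2 :=
  exponential_distribution_exponential_prob__canonical__probability_measure_Probability
    (ltr0Sn R 1).

Lemma exponential2E B : exponential2 B = exponential_prob 2 B.
Proof. by []. Qed.

Lemma measurable_expR_scale (c : R) : measurable_fun setT (fun y : R =>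
  expR (- (c * y))).
Proof.
by apply: measurableT_comp => //; apply: measurableT_comp => //; exact: measurable_funM.
Qed.

(** Multiplied by exp (- c y), the density of rate 2 becomes 2 / (2 + c) times the density of rate 2
    + c, which has mass 1. *)
Lemma laplace_exponential2 (c : R) : 0 <= c ->
  (\int[exponential2]_y (expR (- (c * y)))%:E = (2 / (2 + c))%:E)%E.
Proof.
move=> c0; have c2 : 0 < 2 + c by lra.
have -> : (\int[exponential2]_y (expR (- (c * y)))%:E =
    1%:E * \int[exponential2]_y (expR (- (c * y)))%:E)%E by rewrite mul1e.
rewrite -(@integral_mul_comp _ _ _ _ R lebesgue_measure exponential2 setT _
  idfun (exponential_pdf 2) 1)//.
- transitivity (\int[lebesgue_measure]_x ((2 / (2 + c))%:E * (exponential_pdf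
    (2 + c) x)%:E))%E.
    apply: eq_integral => x _; rewrite -!EFinM; congr EFin.
    have [x0|x0] := leP 0 x; last by rewrite !lt0_exponential_pdf// mul0r mulr0.
    rewrite !exponential_pdfE// mulrA divfK ?gt_eqF// -mulrA -expRD; congr (_ * expR _).
    by rewrite /=; ring.
  rewrite ge0_integralZl ?integral_exponential_pdf ?mule1//.
  - by apply/measurable_EFinP; exact: measurable_exponential_pdf.
  - by move=> x _; rewrite lee_fin exponential_pdf_ge0// ltW.
  - by rewrite lee_fin divr_ge0// ltW.
- exact: measurable_id.
- exact: measurable_exponential_pdf.
- by move=> x; exact: exponential_pdf_ge0.
- by move=> B mB; rewrite mul1e setTI.
- by apply/measurable_EFinP; exact: measurable_expR_scale.
Qed.

Lemma exponential2_pos : exponential2 `]0, +oo[%classic = 1%E.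
Proof.
rewrite exponential2E /exponential_prob integral_itv_obnd_cbnd; last first.
  by apply: measurable_funTS; apply/measurable_EFinP; exact: measurable_exponential_pdf.
rewrite -(integral_exponential_pdf (ltr0Sn R 1)) integral_mkcond.
apply: eq_integral => x _; rewrite patchE; case: ifPn => // x0.
by rewrite /exponential_pdf patchE (negbTE x0).
Qed.

End exponential_laplace.

Section lengths.
Context (d : measure_display) (Omega : measurableType d) (R : realType).
Variables (P : probability Omega R) (n : nat) (G : Omega -> set vertex).
Variables (kappa : vertex -> {RV P >-> R}) (pi : vertex -> Omega -> seq R).
Hypothesis prG : pruning_randomness n G kappa pi.
Hypothesis mG : forall t, measurable (tree_event G (tset t)).

Lemma tset_finite t : finite_set (tset t).
Proof. exact: finite_seq. Qed.

Lemma prod_fset_tset t (F : vertex -> \bar R) :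
  (\prod_(e <- fset_set (tset t)) F e = \prod_(e <- nodes t) F e)%E.
Proof.
apply: perm_big; apply: uniq_perm => //; first exact: nodes_uniq.
by move=> v; rewrite in_fset_set; [apply/idP/idP; rewrite inE|exact: tset_finite].
Qed.

Definition lengths_in (s : seq vertex) (B : vertex -> set R) : set Omega :=
  \bigcap_(e in [set` s]) (kappa e @^-1` B e).

Lemma measurable_lengths_in s B : (forall e, measurable (B e)) ->
  measurable (lengths_in s B).
Proof.
move=> mB; apply: fin_bigcap_measurable; first exact: finite_seq.
by move=> e _; exact: measurable_funPTI.
Qed.

(** [lengths_law] only speaks of sets. Edges are moved one at a time from s2, where a length is
    confined to a set, to s1, where a function of it is integrated; [integral_mul_comp] makes each
    move, and [lengths_law] is the case of an empty s1. *)
Lemma integral_prod_lengths_in t (phi : vertex -> R -> R) (a : vertex -> R)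
    (s1 s2 : seq vertex) (B : vertex -> set R) :
  (forall u, measurable_fun setT (phi u)) -> (forall u y, 0 <= phi u y) ->
  (forall u, 0 <= a u) ->
  (forall u, \int[@exponential2 R]_y (phi u y)%:E = (a u)%:E)%E ->
  perm_eq (s1 ++ s2) (nodes t) -> (forall e, measurable (B e)) ->
  (\int[P]_(w in tree_event G (tset t) `&` lengths_in s2 B)
     (\prod_(u <- s1) phi u (kappa u w))%:E =
   (fine (P (tree_event G (tset t))) * \prod_(u <- s1) a u)%:E *
   \prod_(u <- s2) exponential2 R (B u))%E.
Proof.
move=> mphi phi0 a0 phia; elim: s1 s2 B => [|u s1 IH] s2 B ps mB.
  under eq_integral do rewrite big_nil.
  rewrite integral_cst//=; last first.
    by apply: measurableI => //; exact: measurable_lengths_in.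
  rewrite mul1e big_nil mulr1 fineK ?fin_num_measure//.
  have := lengths_law prG (tset_finite t) mB; rewrite prod_fset_tset.
  rewrite (perm_big _ ps)/= => <-; rewrite /lengths_in.
  suff -> : [set` s2] = tset t by [].
  by apply/seteqP; split => e /=; rewrite /tset/= -(perm_mem ps).
under eq_integral do rewrite big_cons mulrC EFinM.
have us : u \notin s1 ++ s2.
  by have := nodes_uniq t; rewrite -(perm_uniq ps) => /andP[].
pose Bu (B0 : set R) v := if v == u then B0 else B v.
pose q := \prod_(v <- s2) fine (exponential2 R (B v)).
have qE : (\prod_(v <- s2) exponential2 R (B v) = q%:E)%E.
  rewrite /q -prodEFin; apply: eq_bigr => v _.
  by rewrite fineK//; exact: (fin_num_measure (exponential2 R) _ (mB v)).
have q0 : 0 <= q by apply: prodr_ge0 => v _; rewrite fine_ge0.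
have p0 : 0 <= fine (P (tree_event G (tset t))) by rewrite fine_ge0.
pose C := fine (P (tree_event G (tset t))) * \prod_(v <- s1) a v * q.
rewrite (@integral_mul_comp _ _ _ _ _ P (exponential2 R) _ _ (kappa u)
  (fun w => \prod_(v <- s1) phi v (kappa v w)) C _ _ _ _ (EFin \o phi u)).
- by rewrite phia qE -!EFinM /C big_cons; congr EFin; ring.
- by apply: measurableI => //; exact: measurable_lengths_in.
- exact: (measurable_funPT (kappa u)).
- apply: measurable_prod => v _; apply: measurableT_comp => //.
- by move=> w; apply: prodr_ge0 => v _.
(* Testing [kappa u] against a set [B0] puts u back among the confined edges, where the induction
   hypothesis applies. *)
- move=> B0 mB0; have := IH (u :: s2) (Bu B0).
  have -> : lengths_in (u :: s2) (Bu B0) = lengths_in s2 B `&` kappa u @^-1` B0.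
    rewrite /lengths_in; apply/seteqP; split => w /=.
      move=> H; split=> [v vs|]; last first.
        by have := H u; rewrite /= mem_head /Bu eqxx; exact.
      have := H v; rewrite /= in_cons vs orbT /Bu => /(_ isT).
      by case: eqP => // vu; move: us; rewrite mem_cat -vu vs orbT.
    move=> [H1 H2] v /=; rewrite in_cons /Bu; case: eqP => [-> //|_ /= vs].
    exact: H1.
  rewrite setIA => ->.
  + rewrite big_cons {1}/Bu eqxx muleC -muleA (eq_big_seq (fun v =>
      exponential2 R (B v))); last first.
      move=> v vs; rewrite /Bu; case: eqP => // vu.
      by move: us; rewrite mem_cat -vu vs orbT.
    by rewrite qE -EFinM muleC /C (mulrC q).
  + by rewrite -[u :: s2]cat1s perm_catCA.
  + by move=> e; rewrite /Bu; case: ifP.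
- by apply/measurable_EFinP; exact: mphi.
- by move=> y; rewrite lee_fin.
Qed.

Lemma integral_prod_lengths t (phi : vertex -> R -> R) (a : vertex -> R) :
  (forall u, measurable_fun setT (phi u)) -> (forall u y, 0 <= phi u y) ->
  (forall u, 0 <= a u) ->
  (forall u, \int[@exponential2 R]_y (phi u y)%:E = (a u)%:E)%E ->
  (\int[P]_(w in tree_event G (tset t)) (\prod_(u <- nodes t) phi u (kappa u w))%:E =
   P (tree_event G (tset t)) * (\prod_(u <- nodes t) a u)%:E)%E.
Proof.
move=> mphi phi0 a0 phia.
have := @integral_prod_lengths_in t phi a (nodes t) [::] (fun=> setT) mphi phi0 a0 phia.
rewrite cats0 => /(_ (perm_refl _) (fun=> measurableT)).
rewrite /lengths_in set_nil bigcap_set0 setIT => ->.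
by rewrite big_nil mule1 EFinM fineK// fin_num_measure.
Qed.

Lemma lengths_pos_ae t : P (tree_event G (tset t) `&`
  [set w | forall e, e \in nodes t -> 0 < kappa e w]) = P (tree_event G (tset t)).
Proof.
have := lengths_law prG (tset_finite t) (fun=> measurable_itv `]0, +oo[).
rewrite prod_fset_tset big1 ?mule1 => [<-|e _]; last exact: exponential2_pos.
  congr (P (_ `&` _)); apply/seteqP; split=> w /= H e.
    by move=> /H; rewrite /= in_itv/= andbT.
  by move=> /H; rewrite /= in_itv/= andbT.
Qed.

End lengths.

(** * Slices of a branch *)

Section grid.
Context (R : realType).

(* Rounding strictly up, and to a positive value whatever y is: the rounded
   slices of a branch are disjoint, and each point of a slice `]a, b] belongs
   to the rounded slices as soon as the grid is fine enough. *)
Definition gridup (m : nat) (y : R) : R := (Num.truncn (m.+1%:R * y)).+1%:R / m.+1%:R.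

Lemma gridup_gt0 m y : 0 < gridup m y.
Proof. by apply: divr_gt0; rewrite ltr0n. Qed.

Lemma gridup_gt m y : y < gridup m y.
Proof. by rewrite /gridup ltr_pdivlMr ?ltr0n// mulrC truncnS_gt. Qed.

Lemma gridup_le m y : 0 <= y -> gridup m y <= y + m.+1%:R^-1.
Proof.
move=> y0; rewrite /gridup ler_pdivrMr ?ltr0n// mulrDl mulVf ?pnatr_eq0// -natr1 lerD2r.
rewrite (mulrC y); by have /andP[] := truncn_itv (mulr_ge0 (ler0n R m.+1) y0).
Qed.

Lemma measurable_gridcell m k :
  measurable [set y : R | Num.truncn (m.+1%:R * y) = k].
Proof.
apply: is_interval_measurable => x y /= xk yk z /andP[xz zy].
apply/eqP; rewrite eqn_leq -{1}yk -xk !le_truncn//; exact: ler_wpM2l.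
Qed.

Lemma le_gridup m : {homo gridup m : x y / x <= y}.
Proof.
move=> x y xy; rewrite /gridup ler_pM2r ?invr_gt0 ?ltr0n// ler_nat ltnS le_truncn//.
exact: ler_wpM2l.
Qed.

End grid.

Section poisson_zero.
Context (R : realType).

Lemma poisson_prob_zero (l : R) : 0 <= l ->
  poisson_prob l 0%N [set 0%N] = (expR (- l))%:E.
Proof.
rewrite le_eqVlt /poisson_prob => /predU1P[<-|l0].
  by rewrite ltxx oppr0 expR0 diracE mem_set.
rewrite l0 esum_set1; last by rewrite lee_fin poisson_pmf_ge0.
by rewrite /poisson_pmf l0 expr0 fact0 invr1 !mul1r.
Qed.

(** Here a and b will come from rounded lengths while h is the true height of the branch: the slice
    may stick out of the branch or miss it, hence the minimum and the maximum. *)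
Lemma measure_slice (a b h : R) : 0 <= a ->
  fine (lebesgue_measure (`]a, b] `&` `[0, h] : set R)) =
  Num.max 0 (Num.min b h - a).
Proof.
move=> a0; have -> : (`]a, b] `&` `[0, h] : set R) = `]a, Num.min b h]%classic.
  apply/seteqP; split => y /=; rewrite !in_itv/= le_min.
    by move=> [/andP[-> ->] /andP[_ ->]].
  by move=> /and3P[ay -> ->]; rewrite ay (ltW (le_lt_trans a0 ay)).
rewrite lebesgue_measure_itv/= lte_fin; case: ltP => ab/=.
  by apply/esym/max_idPr; rewrite subr_ge0 ltW.
by apply/esym/max_idPl; rewrite subr_le0.
Qed.
End poisson_zero.

Section prefix_heights.
Context (R : realType).
Implicit Types (kappa : vertex -> R) (u v x : vertex).

Lemma hpar_prefix kappa u x : prefix u x ->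
  hpar kappa u = \sum_(i < size u) kappa (take i x).
Proof.
move=> ux; apply: eq_bigr => i _.
have uE : take (size u) x = u by apply/eqP; move: ux; rewrite prefixE.
by rewrite -[X in take i X]uE take_takel// ltnW.
Qed.

Lemma height_prefix kappa u x : prefix u x ->
  height kappa u = \sum_(i < (size u).+1) kappa (take i x).
Proof.
move=> ux; rewrite heightE (hpar_prefix _ ux) big_ord_recr/=; congr (_ + kappa _).
by apply/esym/eqP; move: ux; rewrite prefixE.
Qed.

Lemma sum_take_le kappa x i j : (i <= j)%N -> (forall v, 0 <= kappa v) ->
  \sum_(l < i) kappa (take l x) <= \sum_(l < j) kappa (take l x).
Proof.
move=> ij k0; rewrite -!(big_mkord xpredT (fun l => kappa (take l x))).
by rewrite [leRHS](big_cat_nat (leq0n i) ij)/= lerDl sumr_ge0.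
Qed.

Lemma height_le_hpar kappa u v x : (forall v, 0 <= kappa v) ->
  prefix u x -> prefix v x -> (size u < size v)%N -> height kappa u <= hpar kappa v.
Proof.
move=> k0 ux vx uv; rewrite (height_prefix _ ux) (hpar_prefix _ vx).
exact: sum_take_le.
Qed.

Lemma prefix_size_inj u v x : prefix u x -> prefix v x -> size u = size v -> u = v.
Proof. by rewrite !prefixE => /eqP ux /eqP vx uv; rewrite -ux -vx uv. Qed.

(** Two distinct edges on one branch have different depths, and the upper end of the shallower one
    is not above the lower end of the other. Edges outside p get the empty set, so that the family
    can be indexed by all the edges of a tree. *)
Lemma trivIset_slices kappa x (s : seq vertex) (p : pred vertex) :
  (forall v, 0 <= kappa v) -> uniq s -> (forall u, p u -> prefix u x) ->
  trivIset setT (fun i : 'I_(size s) =>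
    let u := nth [::] s i in
    if p u then `]hpar kappa u, height kappa u]%classic else set0 : set R).
Proof.
move=> k0 us px; apply/trivIsetP => i j _ _ ij /=.
case: ifPn => [pi|]; last by rewrite set0I.
case: ifPn => [pj|]; last by rewrite setI0.
set u := nth _ _ i in pi *; set v := nth _ _ j in pj *.
have uv : u != v by rewrite nth_uniq//.
have suv : size u != size v.
  by apply: contra uv => /eqP e; rewrite (prefix_size_inj (px _ pi) (px _ pj) e).
rewrite -subset0 => y /=; rewrite !in_itv/= => -[/andP[h1 h2] /andP[h3 h4]].
move: suv; rewrite neq_ltn => /orP[] suv.
  have := height_le_hpar k0 (px _ pi) (px _ pj) suv.
  by move: h2 h3; lra.
have := height_le_hpar k0 (px _ pj) (px _ pi) suv.
by move: h1 h4; lra.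
Qed.

End prefix_heights.

(** * Discretised lengths *)

Section discretization.
Context (d : measure_display) (Omega : measurableType d) (R : realType).
Variables (P : probability Omega R) (n : nat) (G : Omega -> set vertex).
Variables (kappa : vertex -> {RV P >-> R}) (pi : vertex -> Omega -> seq R).
Hypothesis prG : pruning_randomness n G kappa pi.
Hypothesis mG : forall t, measurable (tree_event G (tset t)).

(* On {grid_code m (nodes t) = z} the rounded slices depend on z only, which
   is what makes [marks_law] applicable. *)
Definition grid_code (m : nat) (s : seq vertex) (w : Omega) : seq nat :=
  [seq Num.truncn (m.+1%:R * kappa e w) | e <- s].

(** Total and nonnegative for every z, even one that is the code of no outcome: disjointness of the
    slices is later asked for all z. *)
Definition grid_decode (m : nat) (s : seq vertex) (z : seq nat) (e : vertex) : R :=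
  (nth 0%N z (index e s)).+1%:R / m.+1%:R.

Lemma grid_decode_code m s e w : e \in s ->
  grid_decode m s (grid_code m s w) e = gridup m (kappa e w).
Proof. by move=> es; rewrite /grid_decode (nth_map [::]) ?index_mem// nth_index. Qed.

Lemma grid_decode_ge0 m s z e : 0 <= grid_decode m s z e.
Proof. by apply: divr_ge0; rewrite ler0n. Qed.

Lemma sigma_lengths_grid_code t m z s : {subset s <= nodes t} ->
  sigma_lengths kappa (tset t) [set w | grid_code m s w = z].
Proof.
have [S0 SD SU] := smallest_sigma_algebra setT
  [set F | exists (e : vertex) (B : set R),
         [/\ tset t e, measurable B & F = kappa e @^-1` B]].
have ST : sigma_lengths kappa (tset t) setT.
  by rewrite -(setD0 setT); exact: SD.
have SI A B : sigma_lengths kappa (tset t) A ->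
    sigma_lengths kappa (tset t) B -> sigma_lengths kappa (tset t) (A `&` B).
  move=> SA SB; have -> : A `&` B = setT `\` ((setT `\` A) `|` (setT `\` B)).
    by rewrite !setTD setCU !setCK.
  apply: (SD); rewrite -bigcup2E; apply: (SU) => -[|[|k]] //=; exact: SD.
elim: s z => [|e s IH] z st.
  case: z => [|k z]; first by rewrite [X in sigma_lengths _ _ X](_ : _ =
    setT)//; apply/seteqP.
  by rewrite [X in sigma_lengths _ _ X](_ : _ = set0)//; apply/seteqP; split.
case: z => [|k z].
  by rewrite [X in sigma_lengths _ _ X](_ : _ = set0)//; apply/seteqP; split.
rewrite [X in sigma_lengths _ _ X](_ : _ =
    (kappa e @^-1` [set y : R | Num.truncn (m.+1%:R * y) = k]) `&`
    [set w | grid_code m s w = z]).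
  apply: SI; last by apply: IH => v vs; apply: st; rewrite in_cons vs orbT.
  apply: sub_sigma_algebra; exists e, [set y : R | Num.truncn (m.+1%:R * y) = k].
  split => //; [exact/st/mem_head|exact: measurable_gridcell].
by apply/seteqP; split => w /=; [case|move=> [-> ->]].
Qed.

Lemma measurable_grid_code m s z : measurable [set w | grid_code m s w = z].
Proof.
elim: s z => [|e s IH] z.
  case: z => [|k z]; first by rewrite [X in measurable X](_ : _ = setT)//; apply/seteqP.
  by rewrite [X in measurable X](_ : _ = set0)//; apply/seteqP; split.
case: z => [|k z].
  by rewrite [X in measurable X](_ : _ = set0)//; apply/seteqP; split.
rewrite [X in measurable X](_ : _ =
    (kappa e @^-1` [set y : R | Num.truncn (m.+1%:R * y) = k]) `&`
    [set w | grid_code m s w = z]).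
  by apply: measurableI => //; apply: measurable_funPTI => //;
    exact: measurable_gridcell.
by apply/seteqP; split => w /=; [case|move=> [-> ->]].
Qed.

Definition no_points t r (A : vertex -> 'I_r -> set R) : set Omega :=
  \bigcap_(x in internal (tset t)) \bigcap_i
     [set w | nb_points pi (A x i) x w = 0%N].

Lemma internal_finite t : finite_set (internal (tset t)).
Proof.
apply: (@sub_finite_set _ _ [set` inodes t]) => // x /internal_tset //.
Qed.

Lemma measurable_no_points t r (A : vertex -> 'I_r -> set R) :
  (forall x i, measurable (A x i)) -> measurable (no_points t A).
Proof.
move=> mA; apply: fin_bigcap_measurable; first exact: internal_finite.
move=> x _; apply: fin_bigcap_measurable => //.
by move=> i _; exact: (nb_points_measurable prG).
Qed.

Lemma prod_fset_internal t (F : vertex -> \bar R) :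
  (\prod_(e <- fset_set (internal (tset t))) F e = \prod_(e <- inodes t) F e)%E.
Proof.
apply: perm_big; apply: uniq_perm => //; first exact: inodes_uniq.
move=> v; rewrite in_fset_set; last exact: internal_finite.
by apply/idP/idP; rewrite inE => /internal_tset.
Qed.

(** The tree event is cut into the countably many cells on which the code is constant. On a cell the
    sets A are deterministic and [marks_law] applies; countable additivity puts the cells together.
    The function g is a measurable form of the conditional probability. *)
Lemma prob_no_points_discretized t m r (A : seq nat -> vertex -> 'I_r -> set R)
    (g : Omega -> R) :
  let code := grid_code m (nodes t) in
  (forall z x i, measurable (A z x i)) ->
  (forall z x, trivIset setT (A z x)) ->
  measurable_fun setT g -> (forall w, 0 <= g w) ->
  (forall w, tree_event G (tset t) w ->
    (\prod_(x <- inodes t) \prod_(i < r)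
       poisson_prob (intensity n kappa (A (code w) x i) x w) 0 [set 0%N])%E =
    (g w)%:E) ->
  let E := tree_event G (tset t) `&` [set w | no_points t (A (code w)) w] in
  measurable E /\ P E = (\int[P]_(w in tree_event G (tset t)) (g w)%:E)%E.
Proof.
move=> code mA tA mg g0 gE S.
(* Numbering the codes by [pickle] turns the cells into a sequence; numbers that encode nothing give
   empty cells. *)
pose F k := tree_event G (tset t) `&` [set w | choice.pickle (code w) = k].
have mF k : measurable (F k).
  apply: measurableI => //.
  have [[z zk]|nz] := pselect (exists z : seq nat, choice.pickle z = k).
    rewrite [X in measurable X](_ : _ = [set w | code w = z]).
      exact: measurable_grid_code.
    by apply/seteqP; split => w /=; rewrite -zk;
      [move=> /(pcan_inj choice.pickleK)|move=> ->].
  rewrite [X in measurable X](_ : _ = set0)//.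
  by apply/seteqP; split => // w /= wk; apply: nz; exists (code w).
have FU : \bigcup_k F k = tree_event G (tset t).
  by apply/seteqP; split => w => [[k _ []]//|Tw]; exists (choice.pickle (code w)).
have tF : trivIset setT F.
  by apply/trivIsetP => i j _ _ ij;
    rewrite -subset0 => w [[_ /= wi] [_ /= wj]]; move: ij; rewrite -wi -wj eqxx.
pose E k := F k `&` [set w | no_points t (A (code w)) w].
have EP k : measurable (E k) /\ P (E k) = (\int[P]_(w in F k) (g w)%:E)%E.
  have [[w0 [_ /= w0k]]|nw] := pselect (exists w, F k w); last first.
    have F0 : F k = set0 by apply/seteqP; split => // w Fw; apply: nw; exists w.
    by rewrite /E F0 set0I measure0 integral_set0; split.
  pose z := code w0.
  have codeE w : (choice.pickle (code w) = k) <-> (code w = z).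
    by rewrite -w0k; split; [move=> /(pcan_inj choice.pickleK)|move=> ->].
  have FE : F k = tree_event G (tset t) `&` [set w | code w = z].
    by apply/seteqP; split => w [Tw /= /codeE].
  have EE : E k = tree_event G (tset t) `&` [set w | code w = z] `&` no_points t (A z).
    by rewrite /E FE; apply/seteqP; split=> w [[Tw /= wz] nw]; split => //=;
      move: nw => /=; rewrite wz.
  split; first by rewrite EE -FE; apply: measurableI => //; exact: measurable_no_points.
  have SF : sigma_lengths kappa (tset t) [set w | code w = z].
    exact: sigma_lengths_grid_code.
  have := marks_law prG (fun=> fun=> 0%N) (tset_finite t) SF (mA z) (tA z).
  rewrite EE => ->; rewrite FE; apply: eq_integral => w; rewrite inE => -[Tw /= wz].
  by rewrite prod_fset_internal -(gE _ Tw) wz.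
have SU : S = \bigcup_k E k by rewrite /S -FU setI_bigcupl.
have mS : measurable S.
  by rewrite SU; apply: bigcup_measurable => k _; have [] := EP k.
split => //; rewrite -FU ge0_integral_bigcup//; last 2 first.
- by apply: measurable_funTS; exact/measurable_EFinP.
- by move=> w _; rewrite lee_fin.
rewrite SU measure_semi_bigcup -?SU//.
- by apply: eq_eseriesr => k _; have [] := EP k.
- by move=> k; have [] := EP k.
- by apply: trivIset_setIr.
Qed.

End discretization.

(** * Marks lie on their branch *)

Section eq_heights.
Context (R : realType).
Implicit Types (kappa : vertex -> R) (t : btree).

Lemma eq_hpar kappa kappa' t x : {in nodes t, kappa =1 kappa'} ->
  x \in nodes t -> hpar kappa x = hpar kappa' x.
Proof. by move=> kk xt; apply: eq_bigr => i _; apply: kk; exact: take_nodes. Qed.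

Lemma eq_height kappa kappa' t x : {in nodes t, kappa =1 kappa'} ->
  x \in nodes t -> height kappa x = height kappa' x.
Proof. by move=> kk xt; apply: eq_bigr => i _; apply: kk; exact: take_nodes. Qed.

Lemma le_height kappa kappa' x : (forall e, kappa e <= kappa' e) ->
  height kappa x <= height kappa' x.
Proof. by move=> kk; apply: ler_sum. Qed.

End eq_heights.

Section measure_aux.
Context (d : measure_display) (T : measurableType d) (R : realType).
Variable P : probability T R.

Lemma negligible_setD_eq (A B : set T) : measurable A -> measurable (A `&` B) ->
  P (A `&` B) = P A -> P.-negligible (A `&` ~` B).
Proof.
move=> mA mAB PAB; have -> : A `&` ~` B = A `\` (A `&` B).
  by rewrite setDIr setDv set0U setDE.
exists (A `\` (A `&` B)); split => //; first exact: measurableD.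
transitivity (P A - P (A `&` B))%E; last by rewrite PAB subee// fin_num_measure.
rewrite measureD//; last by rewrite ltey_eq fin_num_measure.
by rewrite setIA setIid.
Qed.

End measure_aux.

Section avoidance.
Context (d : measure_display) (Omega : measurableType d) (R : realType).
Variables (P : probability Omega R) (n : nat) (G : Omega -> set vertex).
Variables (kappa : vertex -> {RV P >-> R}) (pi : vertex -> Omega -> seq R).
Hypothesis prG : pruning_randomness n G kappa pi.
Hypothesis mG : forall t, measurable (tree_event G (tset t)).

Definition kgrid (m : nat) (w : Omega) (e : vertex) : R := gridup m (kappa e w).

Lemma nb_points_eq0 (A : set R) x w :
  nb_points pi A x w = 0%N <-> forall s, s \in pi x w -> ~ A s.
Proof.
rewrite /nb_points; split=> [/eqP|H].
  by rewrite -leqn0 leqNgt -has_count => /hasPn H s /H/negP; rewrite inE.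
apply/eqP; rewrite -leqn0 leqNgt -has_count; apply/hasPn => s /H nA.
by apply/negP; rewrite inE.
Qed.

Definition marks_below (m : nat) (t : btree) : set Omega := [set w |
  forall x, x \in inodes t -> all (fun s => 0 < s <= height (kgrid m w) x) (pi x w)].

(** The two sets of A cover what lies outside []0, h]], h being the rounded height. Rounding goes
    upwards, so they meet the true branch in a null set, and a Poisson number of mean 0 vanishes
    almost surely. *)
Lemma marks_below_prob m t :
  measurable (tree_event G (tset t) `&` marks_below m t) /\
  P (tree_event G (tset t) `&` marks_below m t) = P (tree_event G (tset t)).
Proof.
pose A z x (i : 'I_2) : set R := if i == ord0 then `]-oo, 0]%classic
  else `]height (grid_decode R m (nodes t) z) x, +oo[%classic.
have hE w x : x \in inodes t ->
    height (grid_decode R m (nodes t) (grid_code kappa m (nodes t) w)) x =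
      height (kgrid m w) x.
  move=> xt; apply: (@eq_height _ _ _ t); last exact: inodes_nodes.
  by move=> e et; rewrite grid_decode_code.
have [] := @prob_no_points_discretized _ _ _ P n G kappa pi prG mG t m 2 A (cst 1).
- by move=> z x i; rewrite /A; case: ifP => _; exact: measurable_itv.
- move=> z x; apply/trivIsetP => -[[|[|//]] i2] [[|[|//]] j2] _ _ //= _;
    rewrite -subset0 => y /=;
  rewrite /A /= !in_itv/= ?andbT => -[];
  have : 0 <= height (grid_decode R m (nodes t) z) x by (apply: sumr_ge0 =>
    l _; exact: grid_decode_ge0).
  + by move=> h0 y0 /lt_le_trans-/(_ _ y0); rewrite ltNge h0.
  + by move=> h0 /lt_le_trans H /H; rewrite ltNge h0.
- exact: measurable_cst.
- by move=> w; rewrite ler01.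
- move=> w Tw; rewrite big_seq big1// => x xt; rewrite big1// => i _.
  suff -> : intensity n kappa (A (grid_code kappa m (nodes t) w) x i) x w = 0.
    by rewrite poisson_prob_zero// oppr0 expR0.
  rewrite /intensity /A; case: ifP => _.
    have -> : (`]-oo, 0] `&` `[0, height (kappa ^~ w) x] : set R) =
        `[0, Num.min 0 (height (kappa ^~ w) x)]%classic.
      apply/seteqP; split=> y /=; rewrite !in_itv/= le_min.
        by move=> [-> /andP[-> ->]].
      by move=> /and3P[-> -> ->].
    by rewrite lebesgue_measure_itv/= lte_fin lt_min ltxx/= mul0r.
  rewrite hE//.
  have -> : (`]height (kgrid m w) x, +oo[ `&` `[0,
    height (kappa ^~ w) x] : set R) = set0.
    rewrite -subset0 => y /=; rewrite !in_itv/= andbT => -[hy /andP[_ yh]].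
    have := le_height x (fun e => ltW (gridup_gt m (kappa e w))).
    by rewrite leNgt (lt_le_trans hy yh).
  by rewrite measure0 mul0r.
rewrite (eq_integral (cst 1%E))// integral_cst//= mul1e.
have -> : tree_event G (tset t)
  `&` [set w | no_points pi t (A (grid_code kappa m (nodes t) w)) w] =
    tree_event G (tset t) `&` marks_below m t.
  apply/seteqP; split => w [Tw H]; split => //.
    move=> x xt; apply/allP => s sx.
    have Hi i : nb_points pi (A (grid_code kappa m (nodes t) w) x i) x w = 0%N.
      by apply: H => //; apply/internal_tset.
    have /nb_points_eq0/(_ s sx) := Hi ord0.
    have /nb_points_eq0/(_ s sx) := Hi ord_max.
    rewrite /A/= !in_itv/= andbT hE// => /negP h1 /negP h2.
    by rewrite leNgt h1 ltNge h2.
  move=> x /internal_tset xt i _; apply/nb_points_eq0 => s sx.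
  have /allP/(_ _ sx)/andP[s0 sh] := H x xt.
  rewrite /A; case: ifP => _ /=; rewrite in_itv/= ?andbT ?hE//.
    by rewrite leNgt s0.
  by rewrite ltNge sh.
by [].
Qed.

End avoidance.

(** * Refining the grid *)

Section convergence.
Context (R : realType).

Lemma cvg_sum_seq (I : Type) (s : seq I) (f : I -> nat -> R) (l : I -> R) :
  (forall i, f i m @[m --> \oo] --> l i) ->
  \sum_(i <- s) f i m @[m --> \oo] --> \sum_(i <- s) l i.
Proof.
move=> fl; elim: s => [|i s IH].
  by rewrite big_nil; under eq_fun do rewrite big_nil; exact: cvg_cst.
by rewrite big_cons; under eq_fun do rewrite big_cons; exact: cvgD.
Qed.

Lemma cvg_prod_seq (I : eqType) (s : seq I) (f : I -> nat -> R) (l : I -> R) :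
  (forall i, i \in s -> f i m @[m --> \oo] --> l i) ->
  \prod_(i <- s) f i m @[m --> \oo] --> \prod_(i <- s) l i.
Proof.
elim: s => [|i s IH] fl.
  by rewrite big_nil; under eq_fun do rewrite big_nil; exact: cvg_cst.
rewrite big_cons; under eq_fun do rewrite big_cons.
apply: cvgM; first by apply: fl; exact: mem_head.
by apply: IH => j js; apply: fl; rewrite in_cons js orbT.
Qed.

Lemma near_all_seq (I : eqType) (s : seq I) (Q : I -> nat -> Prop) :
  (forall i, i \in s -> \forall m \near \oo, Q i m) ->
  \forall m \near \oo, forall i, i \in s -> Q i m.
Proof.
elim: s => [|i s IH] Qs; first by near=> m.
have Qi := Qs i (mem_head i s).
have {IH} : \forall m \near \oo, forall j, j \in s -> Q j m.
  by apply: IH => j js; apply: Qs; rewrite in_cons js orbT.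
apply: filterS2 Qi => m Qi H j; rewrite in_cons => /predU1P[->//|]; exact: H.
Unshelve. all: by end_near. Qed.

Lemma cvg_gridup (y : R) : 0 <= y -> gridup m y @[m --> \oo] --> y.
Proof.
move=> y0; apply: (@squeeze_cvgr _ _ _ _ (cst y) (fun m => y + m.+1%:R^-1)).
- by near=> m; rewrite (ltW (gridup_gt m y)) gridup_le.
- exact: cvg_cst.
- by rewrite -[X in _ --> X]addr0; apply: cvgD; [exact: cvg_cst|exact: cvg_harmonic].
Unshelve. all: by end_near. Qed.

Lemma cvg_height (kappa : vertex -> R) u : (forall j, 0 <= kappa (take j u)) ->
  height (fun e => gridup m (kappa e)) u @[m --> \oo] --> height kappa u.
Proof. by move=> k0; apply: cvg_sum_seq => i; exact: cvg_gridup. Qed.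

Lemma cvg_hpar (kappa : vertex -> R) u : (forall j, 0 <= kappa (take j u)) ->
  hpar (fun e => gridup m (kappa e)) u @[m --> \oo] --> hpar kappa u.
Proof. by move=> k0; apply: cvg_sum_seq => i; exact: cvg_gridup. Qed.

Lemma le_hpar (kappa kappa' : vertex -> R) x : (forall e, kappa e <= kappa' e) ->
  hpar kappa x <= hpar kappa' x.
Proof. by move=> kk; apply: ler_sum. Qed.

Lemma cvg_slice (kappa : vertex -> R) u h : (forall j, 0 <= kappa (take j u)) ->
  height kappa u <= h ->
  Num.max 0 (Num.min (height (fun e => gridup m (kappa e)) u) h -
             hpar (fun e => gridup m (kappa e)) u) @[m --> \oo] --> kappa u.
Proof.
move=> k0 uh; pose b m := height (fun e => gridup m (kappa e)) u.
pose a m := hpar (fun e => gridup m (kappa e)) u.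
have ab : height kappa u - hpar kappa u = kappa u by rewrite heightE addrAC subrr add0r.
have ha m : hpar kappa u <= a m by apply: le_hpar => e; exact/ltW/gridup_gt.
have hb m : height kappa u <= b m by apply: le_height => e; exact/ltW/gridup_gt.
have a_b m : a m <= b m.
  by rewrite /a /b heightE lerDl ltW// gridup_gt0.
apply: (@squeeze_cvgr _ _ _ _ (fun m => height kappa u - a m) (fun m => b m - a m)).
- near=> m; apply/andP; split.
    by rewrite le_max; apply/orP; right; rewrite lerD2r le_min hb uh.
  by rewrite ge_max subr_ge0 a_b lerD2r ge_min lexx.
- by rewrite -ab; apply: cvgB; [exact: cvg_cst|exact: cvg_hpar].
- by rewrite -ab; apply: cvgB; [exact: cvg_height|exact: cvg_hpar].
Unshelve. all: by end_near. Qed.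

Lemma near_unhit (kappa : vertex -> R) (pi : vertex -> seq R) x u :
  (forall j, 0 <= kappa (take j u)) ->
  \forall m \near \oo,
    unhit (fun e => gridup m (kappa e)) pi x u = unhit kappa pi x u.
Proof.
move=> k0; set km := fun m e => gridup m (kappa e).
have : \forall m \near \oo, forall s, s \in pi x ->
    (hpar (km m) u < s <= height (km m) u) = (hpar kappa u < s <= height kappa u).
  apply: near_all_seq => s _.
  (* Convergence from above decides [s <= l] in the limit even when s = l; both ends of a half-open
     slice are comparisons of this form. *)
  have le_iff (f : nat -> R) l : (forall m, l <= f m) -> f m @[m --> \oo] --> l ->
      \forall m \near \oo, (s <= f m) = (s <= l).
    move=> lf fl; have [sl|ls] := leP s l.
      by near=> m; rewrite (le_trans sl).
    have Hn := cvgr_lt l fl s ls.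
    by near=> m; apply/negbTE; rewrite -ltNge; near: m; exact: Hn.
  have H1 := le_iff _ _ (fun m => le_hpar u (fun e =>
    ltW (gridup_gt m (kappa e)))) (cvg_hpar k0).
  have H2 := le_iff _ _ (fun m => le_height u (fun e =>
    ltW (gridup_gt m (kappa e)))) (cvg_height k0).
  apply: filterS2 H1 H2 => m e1 e2.
  by rewrite !ltNge e1 e2.
apply: filterS => m H; rewrite /unhit; congr negb.
by apply: eq_in_has => s /H.
Unshelve. all: by end_near. Qed.

End convergence.

(** * Avoidance probabilities *)

Lemma measure_setI_negligible (d : measure_display) (T : measurableType d)
  (R : realType)
    (P : probability T R) (A B : set T) : measurable A -> measurable (A `&` B) ->
  P.-negligible (A `&` ~` B) -> P (A `&` B) = P A.
Proof.
move=> mA mAB nAB; have mD : measurable (A `&` ~` B).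
  have -> : A `&` ~` B = A `\` (A `&` B) by rewrite setDIr setDv set0U setDE.
  exact: measurableD.
have AE : A = (A `&` B) `|` (A `&` ~` B) by rewrite -setIUr setUv setIT.
rewrite [in RHS]AE measureU//.
  by rewrite [X in (_ + X)%E]measure_negligible// adde0.
by rewrite setIACA setIid setICr setI0.
Qed.

Section avoidance.
Context (d : measure_display) (Omega : measurableType d) (R : realType).
Variables (P : probability Omega R) (n : nat) (G : Omega -> set vertex).
Variables (kappa : vertex -> {RV P >-> R}) (pi : vertex -> Omega -> seq R).
Hypothesis prG : pruning_randomness n G kappa pi.
Hypothesis mG : forall t, measurable (tree_event G (tset t)).

Definition lengths_pos (t : btree) : set Omega :=
  [set w | forall e, e \in nodes t -> 0 < kappa e w].

Lemma measurable_lengths_pos t : measurable (lengths_pos t).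
Proof.
rewrite [X in measurable X](_ : _ =
  lengths_in kappa (nodes t) (fun=> `]0, +oo[%classic)).
  by apply: measurable_lengths_in => e; exact: measurable_itv.
by apply/seteqP; split=> w /= H e /H /=; rewrite in_itv/= andbT.
Qed.

(** The hypotheses of [pruned_tset]: on this event the exploration of t is given by [rprune]. *)
Definition regular (t : btree) : set Omega :=
  tree_event G (tset t) `&` (lengths_pos t `&` [set w |
    forall x, x \in inodes t ->
    all (fun s => 0 < s <= height (kappa ^~ w) x) (pi x w)]).

(** Lying on the branch compares the marks with a random height, which [marks_law] does not cover.
    Rounded heights decrease to it in the limit, so the condition is the countable intersection of
    its rounded versions. *)
Lemma regularE t : regular t = tree_event G (tset t) `&`
  (lengths_pos t `&` \bigcap_m marks_below kappa pi m t).
Proof.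
apply/seteqP; split => w [Tw [Kw H]]; split => //; split => //.
  move=> m _ x xt; apply: sub_all (H x xt) => s /andP[-> sh]/=.
  by apply: (le_trans sh); apply: le_height => e; exact/ltW/gridup_gt.
move=> x xt; apply/allP => s sx.
have Hm m : 0 < s <= height (kgrid kappa m w)
  x by have /allP := H m Logic.I x xt; exact.
have /andP[-> _] := Hm 0%N; rewrite /= leNgt; apply/negP => hs.
have /(_ _ hs) : forall z, height (kappa ^~ w) x < z ->
    \forall m \near \oo, height (kgrid kappa m w) x < z.
  apply: cvgr_lt; apply: cvg_height => j; apply/ltW/Kw/take_nodes.
  exact: inodes_nodes.
case=> N _ /(_ N)/=; rewrite leqnn => /(_ isT).
by have /andP[_] := Hm N; rewrite leNgt => /negbTE->.
Qed.

Lemma measurable_regular t : measurable (regular t).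
Proof.
rewrite regularE setICA -bigcapIr; last by exists 0%N.
apply: measurableI; first exact: measurable_lengths_pos.
apply: bigcap_measurable; first by exists 0%N.
by move=> m _; have [] := marks_below_prob prG mG m t.
Qed.

Lemma not_regular_negligible t :
  P.-negligible (tree_event G (tset t) `&` ~` regular t).
Proof.
apply: (@negligibleS _ _ _ _ ((tree_event G (tset t) `&` ~` lengths_pos t) `|`
  \bigcup_m (tree_event G (tset t) `&` ~` marks_below kappa pi m t))).
  rewrite regularE => w [Tw nR].
  have [Kw|nK] := pselect (lengths_pos t w); last by left.
  right; apply: contrapT => nU; apply: nR; split => //; split => // m _.
  by apply: contrapT => nm; apply: nU; exists m.
apply: negligibleU.
  apply: negligible_setD_eq => //.
    by apply: measurableI => //; exact: measurable_lengths_pos.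
  exact: (lengths_pos_ae prG).
apply: negligible_bigcup => m.
by have [? ?] := marks_below_prob prG mG m t; exact: negligible_setD_eq.
Qed.

Lemma measure_regular t (A : set Omega) : measurable (tree_event G (tset t) `&` A) ->
  P (regular t `&` A) = P (tree_event G (tset t) `&` A).
Proof.
move=> mA; have -> : regular t `&` A = (tree_event G (tset t) `&` A) `&` regular t.
  by rewrite setIC setIAC setIC /regular; apply/seteqP; split=> w [] // [].
apply: measure_setI_negligible => //.
  by apply: measurableI => //; exact: measurable_regular.
by apply: negligibleS (not_regular_negligible t) => w [[]].
Qed.

Lemma prob_regular t : P (regular t) = P (tree_event G (tset t)).
Proof. by have := @measure_regular t setT; rewrite !setIT; exact. Qed.

Lemma regular_hpos t w x : regular t w -> x \in nodes t ->
  forall j, 0 <= kappa (take j x) w.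
Proof. by move=> [_ [Kw _]] xt j; apply/ltW/Kw/take_nodes. Qed.

Variables (t : btree) (J : vertex -> seq vertex).
Hypothesis uniqJ : forall u, uniq (J u).
Hypothesis inJ : forall u x, x \in J u -> x \in inodes t /\ prefix u x.

(** [J u] lists the nodes whose processes must leave the edge u empty. These are the mark events
    from which the probabilities of all pruned trees are derived. *)
Definition avoid (k : vertex -> R) (pi : vertex -> seq R) : Prop :=
  forall u x, x \in J u -> unhit k pi x u.

Let T := tree_event G (tset t).
Let av_grid m : set Omega := [set w | avoid (kgrid kappa m w) (pi ^~ w)].
Let av : set Omega := [set w | avoid (kappa ^~ w) (pi ^~ w)].

Let edge (i : 'I_(size (nodes t))) : vertex := nth [::] (nodes t) i.

Let edge_in i : edge i \in nodes t.
Proof. by rewrite mem_nth. Qed.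

Let slice m w x u : R := if x \in J u
  then Num.max 0 (Num.min (height (kgrid kappa m w) u) (height (kappa ^~ w) x) -
                  hpar (kgrid kappa m w) u) else 0.

(** Conditional probability of [av_grid m] given the tree and the lengths. *)
Let avg m w : R := \prod_(x <- inodes t) \prod_(i < size (nodes t))
  expR (- (slice m w x (edge i) / n%:R)).

Let measurable_kgrid m e : measurable_fun setT (fun w => kgrid kappa m w e).
Proof.
apply: (@measurableT_comp _ _ _ _ _ _ (gridup m)).
  by apply: nondecreasing_measurable => //; exact: le_gridup.
exact: (measurable_funPT (kappa e)).
Qed.

Let measurable_avg m : measurable_fun setT (avg m).
Proof.
apply: measurable_prod => x _; apply: measurable_prod => i _.
apply: measurableT_comp => //; apply: measurableT_comp => //.
apply: measurable_funM => //; rewrite /slice; case: (x \in J (edge i)) => //.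
apply: measurable_maxr => //; apply: measurable_funB; last first.
  by apply: measurable_sum => l; exact: measurable_kgrid.
apply: measurable_minr; apply: measurable_sum => l; first exact: measurable_kgrid.
exact: (measurable_funPT (kappa _)).
Qed.

Let avg_ge0 m w : 0 <= avg m w.
Proof. by apply: prodr_ge0 => x _; apply: prodr_ge0 => i _; exact: expR_ge0. Qed.

Let avg_le1 m w : avg m w <= 1.
Proof.
have prod01 (I : Type) (s : seq I) (F : I -> R) :
    (forall i, 0 <= F i <= 1) -> 0 <= \prod_(i <- s) F i <= 1.
  move=> F01; elim/big_ind: _ => // [|y z /andP[y0 y1] /andP[z0 z1]].
    by rewrite ler01 lexx.
  by rewrite mulr_ge0// mulr_ile1.
suff /andP[] : 0 <= avg m w <= 1 by [].
apply: (prod01) => x; apply: (prod01) => i; rewrite expR_ge0/=.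
rewrite -expR0 ler_expR oppr_le0 divr_ge0// /slice; case: ifP => // _.
by rewrite le_max lexx.
Qed.

Let in_nodes u x : x \in J u -> u \in nodes t.
Proof.
move=> /inJ[xt /prefixP[s xE]].
by move: (take_nodes (size u) (inodes_nodes xt)); rewrite xE take_size_cat.
Qed.

Let prob_av_grid m : measurable (T `&` av_grid m) /\
  P (T `&` av_grid m) = (\int[P]_(w in T) (avg m w)%:E)%E.
Proof.
pose A z x (i : 'I_(size (nodes t))) : set R := if x \in J (edge i)
  then `]hpar (grid_decode R m (nodes t) z) (edge i),
         height (grid_decode R m (nodes t) z) (edge i)]%classic else set0.
have codeE w u : u \in nodes t -> let z := grid_code kappa m (nodes t) w in
    hpar (grid_decode R m (nodes t) z) u = hpar (kgrid kappa m w) u /\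
    height (grid_decode R m (nodes t) z) u = height (kgrid kappa m w) u.
  move=> ut; split; [apply: (@eq_hpar _ _ _ t)|apply: (@eq_height _ _ _ t)] => // e et;
  by rewrite grid_decode_code.
have [] := @prob_no_points_discretized _ _ _ P n G kappa pi prG mG t m _ A (avg m).
- by move=> z x i; rewrite /A; case: ifP => // _; exact: measurable_itv.
- move=> z x; apply: (@trivIset_slices _ _ x (nodes t) (fun u => x \in J u)).
  + by move=> v; exact: grid_decode_ge0.
  + exact: nodes_uniq.
  + by move=> u /inJ[].
- exact: measurable_avg.
- exact: avg_ge0.
- move=> w Tw; rewrite /avg -prodEFin; apply: eq_bigr => x _.
  rewrite -prodEFin; apply: eq_bigr => i _.
  rewrite /intensity /A /slice; case: ifP => _; last first.
    by rewrite set0I measure0 mul0r poisson_prob_zero.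
  have [-> ->] := codeE w _ (edge_in i).
  rewrite measure_slice; last by apply: sumr_ge0 => l _; exact/ltW/gridup_gt0.
  by rewrite poisson_prob_zero// divr_ge0// le_max lexx.
move=> mE PE; suff EE : T `&` [set w | no_points pi t (A (grid_code kappa m
  (nodes t) w)) w] =
    T `&` av_grid m by rewrite -EE.
apply/seteqP; split => w [Tw H]; split => //.
  move=> u x xJ; have [xt ux] := inJ xJ.
  have ut := in_nodes xJ.
  have iu : (index u (nodes t) < size (nodes t))%N by rewrite index_mem.
  have := H x (iffRL (internal_tset t x) xt) (Ordinal iu) Logic.I.
  rewrite /A /edge/= nth_index// xJ => /nb_points_eq0 np.
  have [e1 e2] := codeE w u ut; rewrite e1 e2 in np.
  by apply/hasPn => s /np/= /negP; rewrite in_itv.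
move=> x _ i _; apply/nb_points_eq0 => s sx; rewrite /A; case: ifP => xJ; last by case.
have [-> ->] := codeE w _ (edge_in i); rewrite /= in_itv/=.
by have /hasPn/(_ s sx)/negP := H _ _ xJ.
Qed.

Let lim_avg w : R := \prod_(x <- inodes t) \prod_(i < size (nodes t))
  expR (- ((if x \in J (edge i) then kappa (edge i) w else 0) / n%:R)).

Let cvg_avg w : regular t w -> avg m w @[m --> \oo] --> lim_avg w.
Proof.
move=> rw; apply: cvg_prod_seq => x xt; apply: cvg_prod_seq => i _.
apply: continuous_cvg; first exact: continuous_expR.
apply: cvgN; apply: cvgMl; rewrite /slice; case: ifP => [xJ|_]; last exact: cvg_cst.
have [_ ux] := inJ xJ.
apply: (@cvg_slice _ (kappa ^~ w)); first exact/regular_hpos/edge_in.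
have k0 j : 0 <= kappa (take j x) w by apply: (regular_hpos rw); exact: inodes_nodes.
rewrite (height_prefix _ ux) (height_prefix _ (prefix_refl x)).
have /prefixP[s xE] := ux.
have le_sz : (size (edge i) <= size x)%N by rewrite [in leqRHS]xE size_cat leq_addr.
rewrite -!(big_mkord xpredT (fun l => kappa (take l x) w)).
by rewrite [leRHS](big_cat_nat (leq0n _)
  (_ : ((size (edge i)).+1 <= _)%N))//= lerDl sumr_ge0.
Qed.

(** Exchanging the products, the edge u contributes one factor exp (- kappa_u / n) for each node of
    [J u]. *)
Let lim_avgE w : lim_avg w =
  \prod_(u <- nodes t) expR (- ((size (J u))%:R / n%:R * kappa u w)).
Proof.
rewrite /lim_avg exchange_big/= [RHS](big_nth [::]) big_mkord; apply: eq_bigr => i _.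
rewrite -expR_sum sumrN -mulr_suml -big_mkcond/= big_const_seq iter_addr_0.
suff -> : count (fun x => x \in J (edge i)) (inodes t) = size (J (edge i)).
  by congr (expR (- _)); rewrite -(mulr_natl (kappa _ w)) mulrAC.
rewrite -size_filter; apply: perm_size; apply: uniq_perm => //.
  by rewrite filter_uniq// inodes_uniq.
by move=> x; rewrite mem_filter; case: (boolP (x \in J _)) => //= /inJ[->].
Qed.

Let near_av w : regular t w -> \forall m \near \oo, av_grid m w = av w.
Proof.
move=> rw; have : \forall m \near \oo, forall u, u \in nodes t -> forall x, x \in J u ->
    unhit (kgrid kappa m w) (pi ^~ w) x u = unhit (kappa ^~ w) (pi ^~ w) x u.
  apply: near_all_seq => u ut; apply: near_all_seq => x xJ.
  by apply: (@near_unhit _ (kappa ^~ w)); exact: regular_hpos rw ut.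
apply: filterS => m H; apply/propext; split=> Hw u x xJ.
  by rewrite -H ?Hw//; exact: in_nodes xJ.
by rewrite H ?Hw//; exact: in_nodes xJ.
Qed.

Let measurable_regular_av_grid m : measurable (regular t `&` av_grid m).
Proof.
have -> : regular t `&` av_grid m = (T `&` av_grid m) `&` regular t.
  by apply/seteqP; split => w; [move=> [[Tw rw] aw]|move=> [[Tw aw] rw]].
by apply: measurableI; [have [] := prob_av_grid m|exact: measurable_regular].
Qed.

Lemma measurable_regular_avoid : measurable (regular t `&` av).
Proof.
(* At each point of [regular t] the rounded events eventually agree with [av], which is therefore
   their lower limit. *)
have -> : regular t `&` av = \bigcup_N \bigcap_k (regular t `&` av_grid (N + k)%N).
  apply/seteqP; split => [w [rw aw]|w [N _ H]].
    have [N _ HN] := near_av rw; exists N => // k _; split => //.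
    by rewrite HN//= leq_addr.
  have [rw _] := H 0%N Logic.I; split => //.
  have [N' _ HN'] := near_av rw.
  have [_] := H N' Logic.I; rewrite HN'//=; exact: leq_addl.
apply: bigcup_measurable => N _; apply: bigcap_measurable; first by exists 0%N.
by move=> k _; exact: measurable_regular_av_grid.
Qed.

(** For every m, the mean of the indicator of [av_grid m] is the mean of [avg m]. Both sides pass to
    the limit by dominated convergence, with bound 1, and the limit is a product of Laplace
    transforms of independent exponential lengths. *)
Lemma prob_avoid : P (regular t `&` av) =
  (P T * (\prod_(u <- nodes t) (2 / (2 + (size (J u))%:R / n%:R)))%:E)%E.
Proof.
have mT : measurable T := mG t.
have ione (k : R) : P.-integrable T (EFin \o cst k).
  exact: finite_measure_integrable_cst.
have cvg1 : (\int[P]_(w in T) (\1_(regular t `&` av_grid m) w)%:E)%E @[m --> \oo] -->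
    (\int[P]_(w in T) (\1_(regular t `&` av) w)%:E)%E.
  have [] := @dominated_convergence _ _ _ P T mT
    (fun m w => (\1_(regular t `&` av_grid m) w)%:E)
    (fun w => (\1_(regular t `&` av) w)%:E) (EFin \o cst 1) _ _ _ (ione 1) _ => //.
  - by move=> m; apply/measurable_EFinP; apply: measurable_indic.
  - by apply/measurable_EFinP; apply: measurable_indic; exact: measurable_regular_avoid.
  - apply: aeW => w _; apply: cvg_near_cst.
    have [rw|nrw] := pselect (regular t w).
      near=> m; rewrite !indicE; congr ((_ : bool)%:R%:E).
      have E : av_grid m w = av w by near: m; exact: near_av.
      by apply/idP/idP; rewrite !inE => -[_ ?]; split => //; rewrite ?E// -E.
    near=> m; rewrite !indicE; congr ((_ : bool)%:R%:E).
    by apply/idP/idP; rewrite !inE => -[].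
  - apply: aeW => w m _ /=; rewrite lee_fin indicE.
    by case: (_ \in _); rewrite /= ?normr1 ?normr0.
have cvg2 : (\int[P]_(w in T) (avg m w)%:E)%E @[m --> \oo] -->
    (\int[P]_(w in T) (lim_avg w)%:E)%E.
  have [] := @dominated_convergence _ _ _ P T mT
    (fun m w => (avg m w)%:E) (fun w =>
      (lim_avg w)%:E) (EFin \o cst 1) _ _ _ (ione 1) _ => //.
  - by move=> m; apply: measurable_funTS; apply/measurable_EFinP; exact: measurable_avg.
  - apply: measurable_funTS; apply/measurable_EFinP.
    apply: measurable_prod => x _; apply: measurable_prod => i _.
    apply: measurableT_comp => //; apply: measurableT_comp => //.
    apply: measurable_funM => //; case: (x \in J (edge i)) => //.
  - apply: negligibleS (not_regular_negligible t) => w /= H.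
    apply: contrapT => nn; apply: H => Tw.
    apply: cvg_EFin; first by near=> m.
    by apply: cvg_avg; apply: contrapT => nr; apply: nn.
  - by apply: aeW => w m _ /=; rewrite lee_fin ger0_norm ?avg_ge0// avg_le1.
have E12 m : (\int[P]_(w in T) (\1_(regular t `&` av_grid m) w)%:E)%E =
    (\int[P]_(w in T) (avg m w)%:E)%E.
  have [mav <-] := prob_av_grid m; rewrite integral_indic//.
  rewrite -measure_regular//; congr (P _).
  by apply/seteqP; split => w; [move=> []|move=> [[Tw rw] aw]].
have : (\int[P]_(w in T) (\1_(regular t `&` av) w)%:E =
    \int[P]_(w in T) (lim_avg w)%:E)%E.
  rewrite -(cvg_lim _ cvg1)// -(cvg_lim _ cvg2)//; congr (lim _).
  by under eq_fun do rewrite E12.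
rewrite integral_indic//; last exact: measurable_regular_avoid.
have -> : (regular t `&` av) `&` T = regular t `&` av.
  by apply/seteqP; split => w; [move=> []|move=> [[Tw rw] aw]].
move=> ->; under eq_integral do rewrite lim_avgE.
rewrite (@integral_prod_lengths _ _ _ P n G kappa pi prG mG t
  (fun u y => expR (- ((size (J u))%:R / n%:R * y)))
  (fun u => 2 / (2 + (size (J u))%:R / n%:R)))//.
- by move=> u; exact: measurable_expR_scale.
- by move=> u; apply: laplace_exponential2; rewrite divr_ge0.
Unshelve. all: by end_near. Qed.

End avoidance.

(** * The law of the pruned tree *)

HB.instance Definition _ := gen_eqMixin btree.
HB.instance Definition _ := gen_choiceMixin btree.

Fixpoint prunings (t : btree) : seq btree :=
  if t is Nd l r then Lf :: [seq Nd a b | a <- prunings l, b <- prunings r]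
  else [:: Lf].

Lemma prunings_uniq t : uniq (prunings t).
Proof.
elim: t => //= l ul r ur; apply/andP; split; first by apply/allpairsP => -[[a b] []].
by apply: allpairs_uniq => // -[a b] [a' b'] _ _ /= [-> ->].
Qed.

Lemma rprune_prunings t B : rprune t B \in prunings t.
Proof.
elim: t B => [|l IHl r IHr] B; first by rewrite /= inE.
rewrite [rprune _ _]/= /prune_root; case: ifP => _; last exact: mem_head.
by rewrite /= inE; apply/orP; right; apply: allpairs_f.
Qed.

Lemma inodes_prunings t s x : s \in prunings t -> x \in inodes s -> x \in inodes t.
Proof.
elim: t s x => [|l IHl r IHr] s x; first by rewrite inE => /eqP->.
rewrite inE => /predU1P[->//|/allpairsP[[a b] /= [al br ->]]].
case: x => [//|i x]; rewrite !mem_inodes_cons.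
by case/orP => /andP[-> /=]; [move=> /(IHl _ _ al)->|move=> /(IHr _ _ br)->;
  rewrite orbT].
Qed.

(** Pairs (a, b) with [lI a + lJ b = k] are grouped by i = [lI a]; since both counts are positive, i
    ranges over 1, ..., k - 1. *)
Lemma sum_convolution (R : comPzRingType) (I J : Type) (sI : seq I) (sJ : seq J)
    (lI : I -> nat) (lJ : J -> nat) (vI : I -> R) (vJ : J -> R) k :
  (forall a, 0 < lI a)%N -> (forall b, 0 < lJ b)%N ->
  \sum_(1 <= i < k) (\sum_(a <- sI | lI a == i) vI a) *
                    (\sum_(b <- sJ | lJ b == (k - i)%N) vJ b) =
  \sum_(a <- sI) \sum_(b <- sJ) (if (lI a + lJ b == k)%N then vI a * vJ b else 0).
Proof.
move=> lI0 lJ0.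
transitivity (\sum_(1 <= i < k) \sum_(a <- sI) \sum_(b <- sJ)
    (if (lI a == i) && (lJ b == (k - i)%N) then vI a * vJ b else 0)).
  apply: eq_bigr => i _; rewrite big_distrlr/= big_mkcond/=; apply: eq_bigr => a _.
  by case: eqP => _ /=; [rewrite big_mkcond|rewrite big1].
rewrite exchange_big/=; apply: eq_bigr => a _; rewrite exchange_big/=.
apply: eq_bigr => b _; case: ifPn => [/eqP abk|abk].
  have ik : lI a \in index_iota 1 k.
    by rewrite mem_index_iota lI0/= -abk -[ltnLHS]addn0 ltn_add2l.
  rewrite (bigD1_seq _ ik) ?iota_uniq//= eqxx -abk addKn eqxx/= big1 ?addr0// => i.
  by rewrite eq_sym => /negbTE->.
rewrite big_nat big1// => i /andP[_ ik]; case: ifPn => // /andP[/eqP ai /eqP bi].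
by move: abk; rewrite ai bi subnKC ?eqxx// ltnW.
Qed.

Section pruning_law.
Context (R : realType).
Variable n : nat.

(** Mean of exp (- k y / n) for y exponential of rate 2: the chance that an edge escapes the marks
    of k nodes. *)
Definition survival (k : nat) : R := 2 / (2 + k%:R / n%:R).

Lemma survival_ge0 k : 0 <= survival k.
Proof. by rewrite divr_ge0// addr_ge0// divr_ge0. Qed.

Lemma survival0 : survival 0 = 1.
Proof. by rewrite /survival mul0r addr0 divff. Qed.

(** Law of the pruned tree given t. A cut root edge leaves [Lf] whatever was above it, so the mass
    of [Lf] is taken to be what the other outcomes leave. *)
Fixpoint prune_prob (t s : btree) : R :=
  match t, s with
  | Lf, Lf => 1
  | Lf, Nd _ _ => 0
  | Nd l r, Nd a b =>
      prune_prob l a * prune_prob r b * survival (size (inodes s))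
  | Nd l r, Lf => 1 - \sum_(a <- prunings l) \sum_(b <- prunings r)
      prune_prob l a * prune_prob r b * survival (size (inodes (Nd a b)))
  end.

Lemma prune_prob_Nd l r a b : prune_prob (Nd l r) (Nd a b) =
  prune_prob l a * prune_prob r b * survival (nleaves a + nleaves b).-1.
Proof. by rewrite -[(nleaves a + nleaves b)%N]/(nleaves (Nd a b)) -size_inodes. Qed.

Definition leaf_prob (t : btree) (k : nat) : R :=
  \sum_(s <- prunings t | nleaves s == k) prune_prob t s.

Lemma leaf_prob_Lf k : (2 <= k)%N -> leaf_prob Lf k = 0.
Proof.
by move=> k2; rewrite /leaf_prob /= big_cons big_nil /=; case: eqP => // k1;
  rewrite -k1 in k2.
Qed.

(** [Lf] has one leaf, so for k >= 2 its complementary mass drops out; a remaining outcome with k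
    leaves has k - 1 internal nodes that must spare the root edge. *)
Lemma leaf_prob_Nd l r k : (2 <= k)%N -> leaf_prob (Nd l r) k =
  survival (k - 1) * \sum_(1 <= i < k) leaf_prob l i * leaf_prob r (k - i).
Proof.
move=> k2; rewrite /leaf_prob sum_convolution; [|exact: nleaves_gt0|exact: nleaves_gt0].
rewrite [prunings _]/= big_cons ifF; last first.
  by apply/negbTE; rewrite neq_ltn k2.
rewrite big_mkcond big_allpairs_dep mulr_sumr; apply: eq_bigr => a _.
rewrite mulr_sumr; apply: eq_bigr => b _.
rewrite -[nleaves (Nd a b)]/(nleaves a + nleaves b)%N; case: eqP => [abk|];
  last by rewrite mulr0.
by rewrite prune_prob_Nd abk subn1 mulrC.
Qed.

End pruning_law.

Section pruning_probability.
Context (d : measure_display) (Omega : measurableType d) (R : realType).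
Variables (P : probability Omega R) (n : nat) (G : Omega -> set vertex).
Variables (kappa : vertex -> {RV P >-> R}) (pi : vertex -> Omega -> seq R).
Hypothesis prG : pruning_randomness n G kappa pi.
Hypothesis mG : forall t, measurable (tree_event G (tset t)).
Variable t0 : btree.

Let hit w : vertex -> vertex -> bool := unhit (kappa ^~ w) (pi ^~ w).
Let av (J : vertex -> seq vertex) : set Omega :=
  [set w | avoid J (kappa ^~ w) (pi ^~ w)].
Let valid (J : vertex -> seq vertex) : Prop := (forall u, uniq (J u)) /\
  (forall u x, x \in J u -> x \in inodes t0 /\ prefix u x).
Let weight (J : vertex -> seq vertex) : R :=
  \prod_(u <- nodes t0) survival R n (size (J u)).
Let cat_marks (J K : vertex -> seq vertex) u := J u ++ K u.

(* D is independent of the marks on the edges satisfying U. *)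
Definition indep_edges (U : pred vertex) (D : set Omega) : Prop :=
  [/\ measurable D, D `<=` regular G kappa pi t0 &
   forall J, valid J -> (forall u, J u != [::] -> U u) ->
     P (D `&` av J) = (P D * (weight J)%:E)%E].

Let avU (J K : vertex -> seq vertex) : av J `&` av K = av (cat_marks J K).
Proof.
apply/seteqP; split => w /=; rewrite /avoid.
  by move=> [HJ HK] u x; rewrite mem_cat => /orP[/HJ|/HK].
by move=> H; split => u x xJ; apply: H; rewrite mem_cat xJ ?orbT.
Qed.

Let disj (J K : vertex -> seq vertex) : Prop := forall u, J u != [::] -> K u = [::].

Let valid_cat J K : disj J K -> valid J -> valid K -> valid (cat_marks J K).
Proof.
move=> dJK [uJ iJ] [uK iK]; split => u.
  rewrite /cat_marks; case: (eqVneq (J u) [::]) => [->|/dJK->]; first exact: uK.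
  by rewrite cats0; exact: uJ.
by move=> x; rewrite mem_cat => /orP[/iJ|/iK].
Qed.

Let weight_cat J K : disj J K -> weight (cat_marks J K) = weight J * weight K.
Proof.
move=> dJK; rewrite /weight -big_split/=; apply: eq_bigr => u _; rewrite /cat_marks.
case: (eqVneq (J u) [::]) => [->|/dJK->]; first by rewrite survival0 mul1r.
by rewrite cats0 survival0 mulr1.
Qed.

Let measurable_av D J : measurable D -> D `<=` regular G kappa pi t0 -> valid J ->
  measurable (D `&` av J).
Proof.
move=> mD DR [uJ iJ].
have -> : D `&` av J = D `&` (regular G kappa pi t0 `&` av J).
  by apply/seteqP; split => w; [move=> [Dw Jw]; split => //; split => //;
    exact: DR|move=> [Dw []]].
by apply: measurableI => //; apply: (measurable_regular_avoid prG mG).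
Qed.

Lemma indep_edges_regular U : indep_edges U (regular G kappa pi t0).
Proof.
split => //; first exact: (measurable_regular prG mG).
move=> J [uJ iJ] _; by rewrite (prob_avoid prG mG uJ iJ) (prob_regular prG mG).
Qed.

(** Weights multiply over disjoint sets of edges: adding [av J] to D uses up the edges of V and
    leaves independence on those of W. *)
Lemma indep_edges_avoid (U V W : pred vertex) D J :
  {subset V <= U} -> {subset W <= U} -> (forall u, V u -> W u -> False) ->
  valid J -> (forall u, J u != [::] -> V u) ->
  indep_edges U D -> indep_edges W (D `&` av J).
Proof.
move=> VU WU VW vJ JV [mD DR H]; split.
- exact: measurable_av.
- by move=> w [/DR].
move=> K vK KW; have dJK : disj J K.
  by move=> u /JV Vu; apply/eqP; apply/negP => /negP/KW; exact: VW.
have JU u : J u != [::] -> U u by move=> /JV; exact: VU.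
have JKU u : cat_marks J K u != [::] -> U u.
  rewrite /cat_marks; case: (eqVneq (J u) [::]) => [-> /KW|/JU //]; exact: WU.
by rewrite -setIA avU (H _ (valid_cat dJK vJ vK) JKU) (H _ vJ JU)
  weight_cat// EFinM muleA.
Qed.

Definition subtree_at (a : vertex) (t : btree) : Prop :=
  (forall v, v \in nodes t -> a ++ v \in nodes t0) /\
  (forall v, v \in inodes t -> a ++ v \in inodes t0).

Lemma subtree_at_Nd a l r : subtree_at a (Nd l r) ->
  subtree_at (rcons a 0%N) l /\ subtree_at (rcons a 1%N) r.
Proof.
move=> [H1 H2]; split; split => v vt; rewrite cat_rcons.
- by apply: H1; rewrite mem_nodes_cons vt.
- by apply: H2; rewrite mem_inodes_cons vt.
- by apply: H1; rewrite mem_nodes_cons vt orbT.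
- by apply: H2; rewrite mem_inodes_cons vt orbT.
Qed.

Definition prune_event (a : vertex) (t s : btree) : set Omega :=
  [set w | rprune t (fun x u => hit w (a ++ x) (a ++ u)) = s].

Let root_marks (a : vertex) (s : btree) (u : vertex) : seq vertex :=
  if u == a then [seq a ++ x | x <- inodes s] else [::].

Lemma prune_event_Nd a l r s1 s2 : prune_event a (Nd l r) (Nd s1 s2) =
  prune_event (rcons a 0%N) l s1 `&` prune_event (rcons a 1%N) r s2 `&`
  av (root_marks a (Nd s1 s2)).
Proof.
apply/funext => w; apply/propext; rewrite /prune_event [X in X <-> _]/= /prune_root.
have rE i t : rprune t (fun x u => hit w (rcons a i ++ x) (rcons a i ++ u)) =
    rprune t (fun x u => hit w (a ++ i :: x) (a ++ i :: u)).
  by apply: eq_rprune => x u _ _ _; rewrite !cat_rcons.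
rewrite /setI [X in _ <-> X]/= !rE; set t1 := rprune l _; set t2 := rprune r _.
have avE s : av (root_marks a s) w <-> all (fun x =>
  hit w (a ++ x) (a ++ [::])) (inodes s).
  rewrite cats0; split=> [H|/allP H u x].
    apply/allP => x xs; apply: H; rewrite /root_marks eqxx.
    by apply/mapP; exists x.
  rewrite /root_marks; case: eqP => // -> /mapP[y ys ->]; exact: H.
split.
  by case: ifP => // sall [<- <-]; split => //; apply/avE.
by move=> [[-> ->] /avE ->].
Qed.

Let valid_root_marks a t s : subtree_at a t -> s \in prunings t ->
  valid (root_marks a s).
Proof.
move=> [_ at0] st; split=> [u|u x]; rewrite /root_marks; case: eqP => // ua.
  by rewrite map_inj_uniq ?inodes_uniq//; elim: (a) => // i a' IH x y [/IH].
move=> /mapP[y /(inodes_prunings st)/at0 yt ->]; split => //.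
by rewrite ua prefix_prefix.
Qed.

Let weight_root_marks a s : a \in nodes t0 ->
  weight (root_marks a s) = survival R n (size (inodes s)).
Proof.
move=> at0; rewrite /weight (bigD1_seq _ at0) ?nodes_uniq//= /root_marks eqxx size_map.
by rewrite big1 ?mulr1// => u /negbTE->; exact: survival0.
Qed.

Lemma prob_partition (I : eqType) (D : set Omega) (f : Omega -> I) (s : seq I) :
  uniq s -> (forall i, i \in s -> measurable (D `&` [set w | f w = i])) ->
  measurable (D `&` [set w | f w \in s]) /\
  P (D `&` [set w | f w \in s]) = (\sum_(i <- s) P (D `&` [set w | f w = i]))%E.
Proof.
elim: s => [|i s IH] /=.
  rewrite big_nil (_ : _ `&` _ = set0) ?measure0//.
  by apply/seteqP; split => w [].
move=> /andP[ins us] mD; have [] := IH us.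
  by move=> j js; apply: mD; rewrite in_cons js orbT.
move=> mU PU; have mi := mD i (mem_head _ _).
have E : D `&` [set w | f w \in i :: s] =
    (D `&` [set w | f w = i]) `|` (D `&` [set w | f w \in s]).
  rewrite -setIUr; congr (_ `&` _); apply/seteqP; split => w /=; rewrite in_cons.
    by move=> /predU1P[]; [left|right].
  by move=> [->|->]; rewrite ?eqxx ?orbT.
rewrite E; split; first exact: measurableU.
rewrite big_cons -PU measureU//.
rewrite setIACA -subset0 => w [_ [/= fi]]; rewrite fi => i_s.
by move: ins; rewrite i_s.
Qed.

Definition below (a : vertex) : pred vertex := prefix a.

(** The event D is general so that the induction can bring in what is already known of the edge a
    and of the sibling subtree. The edge a is treated first, then the left subtree, then the right
    one. *)
Lemma prob_prune_event a t D s : subtree_at a t -> indep_edges (below a) D ->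
  s \in prunings t ->
  measurable (D `&` prune_event a t s) /\
  P (D `&` prune_event a t s) = (P D * (prune_prob R n t s)%:E)%E.
Proof.
elim: t a D s => [|l IHl r IHr] a D s at0 indD.
  rewrite inE => /eqP->; rewrite (_ : prune_event _ _ _ = setT).
    by rewrite setIT mule1; case: indD.
  by apply/seteqP; split.
have [lt0 rt0] := subtree_at_Nd at0.
have an : a \in nodes t0 by case: at0 => /(_ [::] (nil_nodes _)); rewrite cats0.
have Nd_case s1 s2 : s1 \in prunings l -> s2 \in prunings r ->
    measurable (D `&` prune_event a (Nd l r) (Nd s1 s2)) /\
    P (D `&` prune_event a (Nd l r) (Nd s1 s2)) =
      (P D * (prune_prob R n (Nd l r) (Nd s1 s2))%:E)%E.
  move=> s1l s2r.
  pose J := root_marks a (Nd s1 s2).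
  have vJ : valid J.
    apply: (valid_root_marks at0); rewrite inE; apply/orP; right.
    exact: allpairs_f.
  have Ja u : J u != [::] -> pred1 a u.
    by rewrite /J /root_marks -[pred1 a u]/(u == a); case: (u == a).
  pose child i : vertex := rcons a i.
  have below_child i : {subset below (child i) <= below a}.
    move=> u /prefixP[v ->]; suff : prefix a (child i ++ v) by [].
    by rewrite /child cat_rcons prefix_prefix.
  have a_below : {subset pred1 a <= below a}.
    by move=> u /eqP ->; exact: prefix_refl.
  have child_disj u : below (child 0%N) u -> below (child 1%N) u -> False.
    rewrite /below /child => /prefixP[v ->] /prefixP[v'].
    by rewrite !cat_rcons => /eqP; rewrite eqseq_cat// eqxx.
  have ind1 i : indep_edges (below (child i)) (D `&` av J).
    apply: (@indep_edges_avoid (below a) (pred1 a)) indD => //.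
    move=> u /eqP -> /prefixP[v] /(congr1 size).
    by rewrite size_cat size_rcons; lia.
  have [m1 P1] := IHl _ _ _ lt0 (ind1 0%N) s1l.
  (* The left outcome may be a cut, hence no avoidance event. Its independence from the right edges
     is obtained by applying the left induction hypothesis a second time, with [av K] added to the
     conditioning event. *)
  have ind2 : indep_edges (below (child 1%N))
    (D `&` av J `&` prune_event (child 0%N) l s1).
    have [mDJ DJR HJ] := ind1 1%N.
    split => //; first by move=> w [/DJR].
    move=> K vK K1; rewrite setIAC.
    have ind3 : indep_edges (below (child 0%N)) (D `&` av J `&` av K).
      rewrite -setIA avU; have dJK : disj J K.
        move=> u /Ja /eqP ->; apply/eqP;
          apply/negP => /negP/K1 /prefixP[v] /(congr1 size).
        by rewrite size_cat size_rcons; lia.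
      apply: (@indep_edges_avoid (below a) (fun u =>
        pred1 a u || below (child 1%N) u)) indD.
      - move=> u; rewrite unfold_in => /orP[/a_below//|]; exact: below_child.
      - exact: below_child.
      - move=> u /orP[/eqP-> /prefixP[v] /(congr1 size)|].
          by rewrite size_cat size_rcons; lia.
        by move=> H0 H1; exact: child_disj H1 H0.
      - exact: valid_cat.
      - move=> u; rewrite /cat_marks; case: (eqVneq (J u) [::]) => [-> /K1 ->|/Ja ->//].
        by rewrite orbT.
    have [_ P3] := IHl _ _ _ lt0 ind3 s1l.
    by rewrite P3 P1 HJ// muleAC.
  have [m2 P2] := IHr _ _ _ rt0 ind2 s2r.
  have -> : D `&` prune_event a (Nd l r) (Nd s1 s2) =
      D `&` av J `&` prune_event (child 0%N) l s1 `&` prune_event (child 1%N) r s2.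
    by rewrite prune_event_Nd; apply/seteqP; split => w;
      [move=> [Dw [[? ?] ?]]|move=> [[[? ?] ?] ?]].
  split => //; rewrite P2 P1 prune_prob_Nd -!muleA -!EFinM.
  have [_ _ ->//] := indD; last by move=> u /Ja/a_below.
  rewrite -muleA -EFinM weight_root_marks// size_inodes -[nleaves (Nd _
    _)]/(nleaves _ + nleaves _)%N.
  by congr (_ * _%:E)%E; ring.
rewrite inE => /predU1P[->|/allpairsP[[s1 s2] /= [s1l s2r ->]]]; last exact: Nd_case.
have [mD DR _] := indD.
pose L := [seq Nd a b | a <- prunings l, b <- prunings r].
have uL : uniq L by have := prunings_uniq (Nd l r) => /= /andP[].
pose f w := rprune (Nd l r) (fun x u => hit w (a ++ x) (a ++ u)).
have NdL i : i \in L -> measurable (D `&` [set w | f w = i]).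
  by move=> /allpairsP[[s1 s2] /= [s1l s2r ->]]; have [] := Nd_case s1 s2 s1l s2r.
have [mL PL] := prob_partition uL NdL.
(* [Lf] is the only outcome outside L, so it is reached as a complement. *)
have -> : D `&` prune_event a (Nd l r) Lf = D `\` (D `&` [set w | f w \in L]).
  apply/seteqP; split => w.
    move=> [Dw fw]; split => // -[_ /=]; rewrite /f fw.
    by move=> /allpairsP[[s1 s2] []].
  move=> [Dw nfL]; split => //; apply: contrapT => fw; apply: nfL; split => //.
  have := rprune_prunings (Nd l r) (fun x u => hit w (a ++ x) (a ++ u)).
  by rewrite inE => /predU1P[].
split; first exact: measurableD.
have finP E : measurable E -> (P E = (fine (P E))%:E)%E.
  by move=> mE; rewrite fineK// fin_num_measure.
rewrite measureD//; last by rewrite ltey_eq fin_num_measure.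
rewrite setIA setIid; transitivity (P D - P (D `&` [set w | f w \in L]))%E => //.
rewrite PL /L big_allpairs_dep [prune_prob _ _ _ _]/= (finP _ mD) EFinB.
rewrite muleBr// mule1; congr (_ - _)%E.
rewrite -EFinM mulr_sumr -sumEFin big_seq [RHS]big_seq; apply: eq_bigr => s1 s1l.
rewrite mulr_sumr -sumEFin big_seq [RHS]big_seq; apply: eq_bigr => s2 s2r.
have [_ PNd] := Nd_case s1 s2 s1l s2r.
by rewrite EFinM -finP// -[LHS]/(P (D `&` prune_event a (Nd l r) (Nd s1 s2))) PNd.
Qed.

Lemma prob_leaf_count k :
  let E := regular G kappa pi t0 `&` [set w | nleaves (rprune t0 (hit w)) = k] in
  measurable E /\
  P E = (P (tree_event G (tset t0)) * (leaf_prob R n t0 k)%:E)%E.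
Proof.
pose s := [seq s <- prunings t0 | nleaves s == k].
have st s' : s' \in s -> s' \in prunings t0 by rewrite mem_filter => /andP[].
have root : subtree_at [::] t0 by [].
have PE s' : s' \in prunings t0 ->
    measurable (regular G kappa pi t0 `&` [set w | rprune t0 (hit w) = s']) /\
    P (regular G kappa pi t0 `&` [set w | rprune t0 (hit w) = s']) =
    (P (tree_event G (tset t0)) * (prune_prob R n t0 s')%:E)%E.
  move=> s't; have := prob_prune_event root (indep_edges_regular _) s't.
  by rewrite (prob_regular prG mG).
have [] := @prob_partition _ (regular G kappa pi t0) (fun w => rprune t0 (hit w)) s.
- by rewrite filter_uniq// prunings_uniq.
- by move=> i /st /PE[].
move=> mE PsE E; have -> : E =
  regular G kappa pi t0 `&` [set w | rprune t0 (hit w) \in s].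
  congr (_ `&` _); apply/seteqP; split => w /=;
    rewrite mem_filter rprune_prunings andbT.
    by move/eqP.
  by move/eqP.
split => //; rewrite PsE /leaf_prob big_filter big_seq_cond.
rewrite [in RHS]big_seq_cond -(fineK (fin_num_measure P _ (mG t0)))
  -EFinM mulr_sumr -sumEFin.
apply: eq_bigr => s' /andP[s't _]; have [_ ->] := PE _ s't.
by rewrite EFinM fineK// fin_num_measure.
Qed.

End pruning_probability.

(** * The Galton-Watson tree *)

Lemma prefix_rcons_rcons (v u : vertex) i j :
  prefix (rcons v i) (rcons u j) <-> prefix (rcons v i) u \/ (v = u /\ i = j).
Proof.
split=> [/prefixP[s]|[/prefixP[s ->]|[-> ->]]]; last exact: prefix_refl.
  case/lastP: s => [|s k].
    by rewrite cats0 => /rcons_inj[-> ->]; right.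
  by rewrite -rcons_cat => /rcons_inj[-> _]; left; exact: prefix_prefix.
by rewrite rcons_cat prefix_prefix.
Qed.

Lemma gw_tree_nil off : gw_tree off [::].
Proof. by move=> v i; rewrite prefixs0 -size_eq0 size_rcons. Qed.

Lemma gw_tree_rcons off u i : gw_tree off (rcons u i)
  <-> gw_tree off u /\ (i < off u)%N.
Proof.
split=> [H|[H iu] v j /prefix_rcons_rcons[/H//|[-> ->]//]].
split; last by apply: H; exact: prefix_refl.
by move=> v j vu; apply: H; apply/prefix_rcons_rcons; left.
Qed.

Lemma rcons_nodes t v i : v \in nodes t ->
  (rcons v i \in nodes t) = (v \in inodes t) && (i < 2)%N.
Proof.
elim: t v i => [|l IHl r IHr] [|j v] i vt.
- by rewrite /= inE.
- by move: vt; rewrite inE.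
- by rewrite [rcons _ _]/= mem_nodes_cons !nil_nodes !andbT /=; case: i vt => [|[]].
- rewrite [rcons _ _]/= mem_nodes_cons mem_inodes_cons.
  move: vt; rewrite mem_nodes_cons => /orP[]/andP[/eqP-> vt] /=.
    by rewrite IHl// !orbF.
  by rewrite IHr.
Qed.

Definition offspring_of (t : btree) (v : vertex)
  : nat := if v \in inodes t then 2%N else 0%N.

(** Only the offspring numbers at the vertices of t intervene, so the tree event is a finite
    intersection, to which the product formula of [iid_offspring] applies. *)
Lemma gw_tree_tset off t : gw_tree off = tset t <->
  forall v, v \in nodes t -> off v = offspring_of t v.
Proof.
split=> [e v vt|H].
  have gv : gw_tree off v by rewrite e.
  have lt_off i : (i < off v)%N = (v \in inodes t) && (i < 2)%N.
    rewrite -rcons_nodes//; apply/idP/idP => [iv|].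
      have : gw_tree off (rcons v i) by apply/gw_tree_rcons.
      by rewrite e.
    rewrite -[is_true _]/(tset t (rcons v i)) -e.
    by move=> /gw_tree_rcons[].
  rewrite /offspring_of; case: ifP lt_off => vi lt_off.
    have := lt_off 1%N; have := lt_off 2%N; rewrite /=.
    by case: (off v) => [|[|[]]].
  by have := lt_off 0%N; rewrite /=; case: (off v).
apply/funext => u; apply/propext; rewrite -[tset t u]/(is_true (u \in nodes t)).
elim/last_ind: u => [|u i IH].
  by split => _; [exact: nil_nodes|exact: gw_tree_nil].
rewrite gw_tree_rcons IH; split=> [[ut iu]|uit].
  rewrite rcons_nodes//; move: iu; rewrite H// /offspring_of.
  by case: ifP.
have ut : u \in nodes t.
  by have := take_nodes (size u) uit; rewrite -cats1 take_size_cat.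
split => //; move: uit; rewrite rcons_nodes// H// /offspring_of.
by case: ifP.
Qed.

Section galton_watson.
Context (d : measure_display) (Omega : measurableType d) (R : realType).
Variables (P : probability Omega R) (xi : vertex -> {RV P >-> nat}).
Hypothesis xi_iid : iid_offspring (@critical_binary R) xi.

Let G := fun w : Omega => gw_tree (fun v => xi v w).

(* Each vertex contributes 1/2, be it a leaf or an internal node. *)
Definition tree_weight (t : btree) : R := 2^-1 ^+ size (nodes t).

Lemma tree_weight_Nd l r :
  tree_weight (Nd l r) = 2^-1 * (tree_weight l * tree_weight r).
Proof. by rewrite /tree_weight /= size_cat !size_map exprS exprD. Qed.

Lemma tree_eventE t : tree_event G (tset t) =
  \bigcap_(v in [set` nodes t]) (xi v @^-1` [set offspring_of t v]).
Proof. by apply/seteqP; split => w /=; rewrite /tree_event/= gw_tree_tset. Qed.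

Lemma measurable_tree_event t : measurable (tree_event G (tset t)).
Proof.
rewrite tree_eventE; apply: fin_bigcap_measurable; first exact: finite_seq.
by move=> v _; exact: measurable_funPTI.
Qed.

Lemma prob_tree_event t : P (tree_event G (tset t)) = (tree_weight t)%:E.
Proof.
have := xi_iid [fset v in nodes t]%fset (offspring_of t).
have -> : [set` [fset v in nodes t]%fset] = [set` nodes t].
  by apply/seteqP; split => v /=; rewrite inE.
rewrite -tree_eventE => ->.
rewrite (perm_big (nodes t)); last first.
  apply: uniq_perm; [exact: fset_uniq|exact: nodes_uniq|].
  by move=> v; rewrite inE.
rewrite prodEFin; congr EFin; transitivity (\prod_(v <- nodes t) (2^-1 : R)).
  apply: eq_bigr => v _; rewrite /critical_binary /offspring_of.
  by case: ifP => _ /=; rewrite ?add0r ?addr0 mul1r.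
by rewrite big_const_seq count_predT iter_mulr_1.
Qed.

(** All binary trees of height at most h, an exhaustion along which splitting at the root is
    exact. *)
Fixpoint trees (h : nat) : seq btree :=
  if h is h'.+1 then Lf :: [seq Nd l r | l <- trees h', r <- trees h'] else [:: Lf].

Lemma trees_uniq h : uniq (trees h).
Proof.
elim: h => //= h uh; apply/andP; split; first by apply/allpairsP => -[[a b] []].
by apply: allpairs_uniq => // -[a b] [a' b'] _ _ /= [-> ->].
Qed.

Lemma mem_trees_S h t : (t \in trees h.+1) =
  (t == Lf) || (t \in [seq Nd l r | l <- trees h, r <- trees h]).
Proof. by rewrite /= inE. Qed.

Lemma trees_S h : {subset trees h <= trees h.+1}.
Proof.
elim: h => [|h IH] t; first by rewrite inE => /eqP->; exact: mem_head.
rewrite !mem_trees_S => /predU1P[->|/allpairsP[[l r] [lh rh ->]]].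
  by rewrite eqxx.
by apply/orP; right; apply: allpairs_f; apply: IH.
Qed.

Lemma trees_le h h' : (h <= h')%N -> {subset trees h <= trees h'}.
Proof.
move=> /subnK <-; elim: (h' - h)%N => // k IH t /IH; rewrite addSn; exact: trees_S.
Qed.

Lemma mem_trees t : exists h, t \in trees h.
Proof.
elim: t => [|l [h1 l1] r [h2 r2]]; first by exists 0%N; rewrite inE.
exists (maxn h1 h2).+1; rewrite mem_trees_S; apply/orP; right.
apply: allpairs_f; first exact: trees_le (leq_maxl h1 h2) _ l1.
exact: trees_le (leq_maxr h1 h2) _ r2.
Qed.

Lemma sum_trees_S h (F : btree -> R) : \sum_(t <- trees h.+1) F t =
  F Lf + \sum_(l <- trees h) \sum_(r <- trees h) F (Nd l r).
Proof. by rewrite big_cons big_allpairs_dep. Qed.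

Section families.
Variables (D : btree -> set Omega) (v : btree -> R).
Hypothesis mD : forall t, measurable (D t).
Hypothesis DT : forall t, D t `<=` tree_event G (tset t).
Hypothesis PD : forall t, P (D t) = (v t)%:E.

Lemma prob_exists_tree_seq (s : seq btree) : uniq s ->
  measurable [set w | exists2 t, t \in s & D t w] /\
  P [set w | exists2 t, t \in s & D t w] = (\sum_(t <- s) v t)%:E.
Proof.
elim: s => [|t s IH] /=.
  rewrite big_nil (_ : [set w | _] = set0) ?measure0//.
  by apply/seteqP; split => w [].
move=> /andP[ts us]; have [mU PU] := IH us.
have -> : [set w | exists2 t', t' \in t :: s & D t' w] =
    D t `|` [set w | exists2 t, t \in s & D t w].
  apply/seteqP; split => w /=.
    move=> [t']; rewrite in_cons => /predU1P[->|t's]; first by left.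
    by right; exists t'.
  move=> [Dt|[t' t's Dt']]; first by exists t => //; exact: mem_head.
  by exists t' => //; rewrite in_cons t's orbT.
split; first exact: measurableU.
rewrite big_cons EFinD -PD -PU measureU//.
rewrite -subset0 => w [/DT Tw [t' t's /DT Tw']].
have tt' : t = t' by apply: tset_inj; rewrite -Tw -Tw'.
by move: ts; rewrite tt' t's.
Qed.

Lemma prob_exists_tree :
  measurable [set w | exists t, D t w] /\
  \sum_(t <- trees h) v t @[h --> \oo] --> fine (P [set w | exists t, D t w]).
Proof.
pose U h : set Omega := [set w | exists2 t, t \in trees h & D t w].
have mU h : measurable (U h) by have [] := prob_exists_tree_seq (trees_uniq h).
have PU h : P (U h) = (\sum_(t <- trees h) v t)%:E.
  by have [] := prob_exists_tree_seq (trees_uniq h).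
have UE : [set w | exists t, D t w] = \bigcup_h U h.
  apply/seteqP; split => w /=.
    by move=> [t Dt]; have [h th] := mem_trees t; exists h => //; exists t.
  by move=> [h _ [t _ Dt]]; exists t.
have mUU : measurable (\bigcup_h U h) by exact: bigcup_measurable.
rewrite UE; split => //.
have /fine_cvg : P (U h) @[h --> \oo] --> (fine (P (\bigcup_h U h)))%:E.
  rewrite fineK ?fin_num_measure//; apply: nondecreasing_cvg_mu => //.
  move=> h h' hh'; apply/subsetPset => w [t th Dt]; exists t => //.
  exact: trees_le hh' _ th.
by under eq_fun do rewrite PU.
Qed.

End families.

(** The limit e of the masses of [trees h] satisfies (e - 1)^2 = 0, so there is no smaller fixed
    point to exclude. *)
Lemma prob_finite_tree :
  measurable [set w | exists t, tree_event G (tset t) w] /\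
  P [set w | exists t, tree_event G (tset t) w] = 1%E.
Proof.
have [mE] := prob_exists_tree measurable_tree_event (fun t w => id) prob_tree_event.
set E := [set w | _] in mE *; set e := fine (P E) => eh; split => //.
suff e1 : e = 1 by rewrite -(fineK (fin_num_measure P _ mE)) -/e e1.
pose s h : R := \sum_(t <- trees h) tree_weight t.
have sS h : s h.+1 = 2^-1 + 2^-1 * (s h * s h).
  rewrite /s sum_trees_S; congr (_ + _).
  rewrite mulr_suml mulr_sumr; apply: eq_bigr => l _.
  rewrite mulr_sumr mulr_sumr; apply: eq_bigr => r _; exact: tree_weight_Nd.
have h1 : (s h.+1) @[h --> \oo] --> e by rewrite (cvg_shiftS s).
have h2 : (s h.+1) @[h --> \oo] --> 2^-1 + 2^-1 * (e * e).
  under eq_fun do rewrite sS; apply: cvgD; first exact: cvg_cst.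
  by apply: cvgMr; apply: cvgM.
have : e = 2^-1 + 2^-1 * (e * e) by rewrite -[LHS](cvg_lim _ h1)//; exact: cvg_lim h2.
move=> ee; have : (e - 1) ^+ 2 = 0 by rewrite expr2; lra.
by move/eqP; rewrite sqrf_eq0 subr_eq0 => /eqP.
Qed.

(** Common to both laws. Read [f t k] as the probability of k leaves given the tree t and [rho k] as
    the chance that the root edge is spared when k leaves are left above it, which is 1 without
    marks; the factor 1/2 is the probability that the root branches. *)
Lemma prob_recursion (D : btree -> nat -> set Omega) (f : btree -> nat -> R)
    (rho : nat -> R) :
  (forall t k, measurable (D t k)) ->
  (forall t k, D t k `<=` tree_event G (tset t)) ->
  (forall t k, P (D t k) = (tree_weight t * f t k)%:E) ->
  (forall k, (2 <= k)%N -> f Lf k = 0) ->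
  (forall l r k, (2 <= k)%N -> f (Nd l r) k =
    rho k * \sum_(1 <= i < k) f l i * f r (k - i)%N) ->
  let q k := fine (P [set w | exists t, D t k w]) in
  forall k, (2 <= k)%N -> q k = rho k / 2 * \sum_(1 <= i < k) q i * q (k - i)%N.
Proof.
move=> mD DT PD fLf fNd q k k2.
have qE j := (prob_exists_tree (mD ^~ j) (DT ^~ j) (PD ^~ j)).2.
pose s j h : R := \sum_(t <- trees h) tree_weight t * f t j.
have sS h : s k h.+1 = rho k / 2 * \sum_(1 <= i < k) s i h * s (k - i)%N h.
  rewrite /s sum_trees_S fLf// mulr0 add0r.
  transitivity (\sum_(l <- trees h) \sum_(r <- trees h) \sum_(1 <= i < k)
     rho k / 2 * ((tree_weight l * f l i) * (tree_weight r * f r (k - i)%N))).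
    apply: eq_bigr => l _; apply: eq_bigr => r _.
    rewrite fNd// tree_weight_Nd !mulr_sumr; apply: eq_bigr => i _.
    by ring.
  rewrite mulr_sumr; under eq_bigr do rewrite exchange_big/=.
  rewrite exchange_big/=; apply: eq_bigr => i _.
  rewrite mulr_suml mulr_sumr; apply: eq_bigr => l _.
  by rewrite mulr_sumr mulr_sumr.
have h1 : (s k h.+1) @[h --> \oo] --> q k by rewrite (cvg_shiftS (s k)); exact: qE.
have h2 : (s k h.+1) @[h --> \oo] --> rho k / 2 * \sum_(1 <= i < k) q i * q (k - i)%N.
  under eq_fun do rewrite sS; apply: cvgMr; apply: cvg_sum_seq => i.
  by apply: cvgM; exact: qE.
by rewrite -[LHS](cvg_lim _ h1)//; exact: cvg_lim h2.
Qed.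

End galton_watson.

(** * The two recursions *)

Section catalan.
Context (R : realType).

Definition catalan (m : nat) : R := 'C(2 * m, m)%:R / m.+1%:R.

Let natrS m : m.+1%:R = m%:R + 1 :> R.
Proof. by rewrite natr1. Qed.

Lemma catalan0 : catalan 0 = 1.
Proof. by rewrite /catalan muln0 bin0 divr1. Qed.

Lemma central_binS m :
  (m.+1%:R : R) * 'C(2 * m.+1, m.+1)%:R = 2 * (2 * m.+1%:R - 1) * 'C(2 * m, m)%:R.
Proof.
have e1 : 'C(2 * m, m)%:R * (m`!%:R * m`!%:R) = (2 * m)`!%:R :> R.
  rewrite -!natrM; congr (_%:R); rewrite -(@bin_fact (2 * m) m); last by lia.
  by have -> : (2 * m - m)%N = m by lia.
have e2 : 'C(2 * m.+1, m.+1)%:R * ((m.+1%:R * m`!%:R) * (m.+1%:R * m`!%:R)) =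
    (2 * m).+2%:R * ((2 * m).+1%:R * (2 * m)`!%:R) :> R.
  rewrite -!natrM; congr (_%:R); rewrite -!factS.
  have -> : (2 * m).+2 = (2 * m.+1)%N by lia.
  rewrite -(@bin_fact (2 * m.+1) m.+1); last by lia.
  by have -> : (2 * m.+1 - m.+1)%N = m.+1 by lia.
have f0 : (m`!%:R : R) != 0 by rewrite pnatr_eq0 -lt0n fact_gt0.
have m0 : (m.+1%:R : R) != 0 by rewrite pnatr_eq0.
have h1 : (2 * m).+2%:R = 2 * m.+1%:R :> R by rewrite -natrM; congr (_%:R); lia.
have h2 : (2 * m).+1%:R = 2 * m.+1%:R - 1 :> R by rewrite -h1 -[in RHS]natr1; ring.
rewrite h1 h2 -e1 in e2.
apply: (mulfI m0); apply: (mulfI f0); apply: (mulfI f0).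
transitivity ('C(2 * m.+1,
  m.+1)%:R * (m.+1%:R * m`!%:R * (m.+1%:R * m`!%:R)) : R); first by ring.
by rewrite e2; ring.
Qed.

Lemma catalanS m : (m.+2%:R) * catalan m.+1 = (4 * m%:R + 2) * catalan m.
Proof.
have m0 : (m.+1%:R : R) != 0 by rewrite pnatr_eq0.
rewrite /catalan mulrCA divff ?pnatr_eq0// mulr1.
apply: (mulfI m0); rewrite central_binS.
transitivity ((4 * m%:R + 2) * 'C(2 * m, m)%:R : R); last by field.
by rewrite (natrS m); ring.
Qed.

(* By the symmetry i <-> n - i, weighting the sum by i + 1 multiplies it by
   (n + 2) / 2, and [catalanS] applies to the weighted sum. *)
Lemma catalan_convolution n :
  \sum_(i < n.+1) catalan i * catalan (n - i) = catalan n.+1.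
Proof.
pose S n := \sum_(i < n.+1) catalan i * catalan (n - i).
pose T n := \sum_(i < n.+1) i.+1%:R * (catalan i * catalan (n - i)).
have TS m : 2 * T m = m.+2%:R * S m.
  have -> : 2 * T m = T m + \sum_(i < m.+1)
    (m - i).+1%:R * (catalan i * catalan (m - i)).
    rewrite mulr_natl mulr2n; congr (_ + _).
    rewrite /T (reindex_inj rev_ord_inj)/=; apply: eq_bigr => i _.
    rewrite subSS; have im : (i <= m)%N by rewrite -ltnS.
    by rewrite subKn// (mulrC (catalan _)).
  rewrite /T -big_split/= /S mulr_sumr; apply: eq_bigr => i _.
  rewrite -mulrDl -natrD; congr (_%:R * _); have := ltn_ord i; lia.
have TT m : T m.+1 = catalan m.+1 + 4 * T m - 2 * S m.
  rewrite {1}/T big_ord_recl/= catalan0 subn0 !mul1r -addrA; congr (_ + _).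
  rewrite /T /S !mulr_sumr -sumrB; apply: eq_bigr => i _.
  rewrite /bump/= add1n subSS mulrA catalanS (natrS i); ring.
elim: n => [|n IH].
  rewrite big_ord1 subn0 catalan0 mulr1; have := catalanS 0; rewrite catalan0.
  by rewrite mulr0 add0r mulr1 => h; apply: (@mulfI _ 2); rewrite ?pnatr_eq0// mulr1.
rewrite -/(S n) in IH; rewrite -/(S n.+1).
have := TS n; have := TS n.+1; rewrite TT IH; have := catalanS n.+1.
move=> h1 h2 h3.
have n0 : (n.+3%:R : R) != 0 by rewrite pnatr_eq0.
have e3 : n.+3%:R = n%:R + 3 :> R by rewrite !natrS; ring.
have e2 : n.+2%:R = n%:R + 2 :> R by rewrite !natrS; ring.
apply: (mulfI n0); move: h1 h2 h3; rewrite e3 e2 (natrS n).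
move: (S n.+1) (T n) (catalan n.+1) (catalan n.+2) (n%:R : R) => a b x y z h1 h2 h3.
lra.
Qed.

Lemma catalan_recursion (q : nat -> R) : q 1%N = 2^-1 ->
  (forall k, (2 <= k)%N -> q k = 2^-1 * \sum_(1 <= i < k) q i * q (k - i)%N) ->
  forall k, (1 <= k)%N -> q k = 2 / (4 ^+ k * k%:R) * 'C(2 * k - 2, k - 1)%:R.
Proof.
move=> q1 qE.
(* This scaling absorbs the factor 1/2 of the recursion and turns it into the convolution of the
   Catalan numbers. *)
have qc m : q m.+1 = 2 * catalan m / 4 ^+ m.+1.
  elim/ltn_ind: m => -[|m] IH; first by rewrite q1 catalan0 expr1; lra.
  rewrite qE// big_add1/= big_mkord -catalan_convolution mulr_sumr [in
    RHS]mulr_sumr mulr_suml.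
  apply: eq_bigr => i _; rewrite IH ?ltn_ord//.
  have im : (i <= m)%N by rewrite -ltnS.
  rewrite subSS subSn// IH ?ltnS ?leq_subr//.
  have -> : 4 ^+ m.+2 = 4 ^+ i.+1 * 4 ^+ (m - i).+1 :> R.
    by rewrite -exprD; congr (_ ^+ _); lia.
  by field; rewrite !expf_neq0 ?pnatr_eq0.
case=> // m _; rewrite qc /catalan.
have -> : (2 * m.+1 - 2)%N = (2 * m)%N by lia.
by rewrite subn1/=; field; rewrite addrC natr1 expf_neq0 ?pnatr_eq0.
Qed.

End catalan.

(** * Uniqueness among sequences of mass one *)

Section mass_one_recursion.
Context (R : realType).

Lemma recursion_mono (rho p q : nat -> R) :
  (forall k, 0 <= rho k) -> (forall k, 0 <= p k) -> (forall k, 0 <= q k) ->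
  (forall k, (2 <= k)%N -> p k = rho k * \sum_(1 <= i < k) p i * p (k - i)%N) ->
  (forall k, (2 <= k)%N -> q k = rho k * \sum_(1 <= i < k) q i * q (k - i)%N) ->
  p 1%N <= q 1%N -> forall k, (1 <= k)%N -> p k <= q k.
Proof.
move=> rho0 p0 q0 pE qE pq1; elim/ltn_ind => -[|[|k]] IH //= _.
rewrite pE// qE//; apply: ler_wpM2l => //; rewrite !big_nat.
apply: ler_sum => i /andP[i1 ik]; apply: ler_pM => //; apply: IH => //; lia.
Qed.

Lemma mass_one_recursion_unique (rho : nat -> R) : (forall k, 0 <= rho k) ->
  forall p q : nat -> R, (forall k, 0 <= p k) -> (forall k, 0 <= q k) ->
  p 0%N = 0 -> q 0%N = 0 ->
  (forall k, (2 <= k)%N -> p k = rho k * \sum_(1 <= i < k) p i * p (k - i)%N) ->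
  (forall k, (2 <= k)%N -> q k = rho k * \sum_(1 <= i < k) q i * q (k - i)%N) ->
  (\sum_(k <oo) (p k)%:E = 1)%E -> (\sum_(k <oo) (q k)%:E = 1)%E ->
  forall k, (1 <= k)%N -> p k = q k.
Proof.
move=> rho0.
have lt_contra (p q : nat -> R) : (forall k, 0 <= p k) -> (forall k, 0 <= q k) ->
    p 0%N = 0 -> q 0%N = 0 ->
    (forall k, (2 <= k)%N -> p k = rho k * \sum_(1 <= i < k) p i * p (k - i)%N) ->
    (forall k, (2 <= k)%N -> q k = rho k * \sum_(1 <= i < k) q i * q (k - i)%N) ->
    (\sum_(k <oo) (p k)%:E = 1)%E -> (\sum_(k <oo) (q k)%:E = 1)%E ->
    q 1%N <= p 1%N.
  move=> p0 q0 p00 q00 pE qE ps qs; rewrite leNgt; apply/negP => pq.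
  have pq_le := recursion_mono rho0 p0 q0 pE qE (ltW pq).
  (* The excess at 1 alone: p + e <= q termwise, and summing gives 1 + e_1 <= 1 with e_1 > 0. *)
  pose e k : R := if k == 1%N then q 1%N - p 1%N else 0.
  have e0 k : 0 <= e k by rewrite /e; case: eqP => // _; rewrite subr_ge0 ltW.
  have : (\sum_(k <oo) ((p k)%:E + (e k)%:E) <= \sum_(k <oo) (q k)%:E)%E.
    apply: lee_nneseries => [k _ _|k _]; first by rewrite -EFinD lee_fin addr_ge0.
    rewrite -EFinD lee_fin /e; case: eqP => [->|k1]; first by rewrite addrC subrK.
    by rewrite addr0; case: k k1 => [|k] _; [rewrite p00 q00|exact: pq_le].
  rewrite nneseriesD; [|by move=> k _ _; rewrite lee_fin..].
  rewrite ps qs; have : ((e 1%N)%:E <= \sum_(k <oo) (e k)%:E)%E.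
    have e0' k : (0 <= k)%N -> true -> (0 <= (e k)%:E)%E by rewrite lee_fin.
    have := @nneseries_lim_ge R (fun k => (e k)%:E) xpredT 0 2 e0'.
    by apply: le_trans; rewrite big_nat_recr//= leeDr// big_nat1 lee_fin.
  move=> le1 /(le_trans (leeD2l 1%E le1)); rewrite -EFinD lee_fin /e eqxx.
  by move: pq; lra.
move=> p q p0 q0 p00 q00 pE qE ps qs k k1.
have pq1 : p 1%N = q 1%N.
  by apply/eqP; rewrite eq_le lt_contra// lt_contra.
by apply/eqP; rewrite eq_le; apply/andP; split;
  apply: (recursion_mono rho0) => //; rewrite pq1.
Qed.

Lemma series_from1 (f : nat -> \bar R) : (\sum_(1 <= k <oo) f k =
  \sum_(k <oo) (if (1 <= k)%N then f k else 0))%E.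
Proof. by rewrite eseries_cond eseries_mkcond. Qed.

(** Division by m_0 absorbs the factor 1 / m_0 of the equation. It is legitimate because m_0 <= m_1
    = 1, and m_0 = 0 would force every c_k, hence m_1, to vanish. The entry [c 0] is arbitrary, so p
    is set to 0 there. *)
Lemma solves_E_normalized n (c : nat -> R) : solves_E n c ->
  let p k := if (1 <= k)%N then c k / fine (moment 0 c) else 0 in
  [/\ forall k, 0 <= p k, (\sum_(k <oo) (p k)%:E = 1)%E &
      forall k, (2 <= k)%N -> p k =
        survival R n (k - 1) / 2 * \sum_(1 <= i < k) p i * p (k - i)%N].
Proof.
move=> [c0 c1 cE] p.
pose f i k : \bar R := if (1 <= k)%N then (k%:R ^+ i * c k)%:E else 0%E.
have f0 i k : (0 <= f i k)%E.
  by rewrite /f; case: ifP => // k1; rewrite lee_fin mulr_ge0 ?c0// exprn_ge0.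
have fE i : moment i c = (\sum_(k <oo) f i k)%E by rewrite /moment series_from1.
have m0_ge0 : (0 <= moment 0 c)%E by rewrite fE; apply: nneseries_ge0 => k _ _;
  exact: f0.
have m0_le1 : (moment 0 c <= 1)%E.
  rewrite -c1 !fE; apply: lee_nneseries => [k _ _|k _]; first exact: f0.
  rewrite /f; case: ifP => // k1; rewrite lee_fin expr0 expr1;
    apply: ler_wpM2r; first exact: c0.
  by rewrite ler1n.
have m0_fin : moment 0 c \is a fin_num.
  by rewrite ge0_fin_numE//; apply: le_lt_trans m0_le1 _; rewrite ltry.
have m0_neq0 : fine (moment 0 c) != 0.
  apply/eqP => m00; have m0E : moment 0 c = 0%E by rewrite -(fineK m0_fin) m00.
  suff : moment 1 c = 0%E by rewrite c1 => /eqP; rewrite eqe oner_eq0.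
  rewrite /moment; apply: eseries0 => k k1 _.
  have : (f 0%N k <= moment 0 c)%E.
    rewrite fE; have := @nneseries_lim_ge R (f 0%N) xpredT 0 k.+1 (fun k _ _ =>
      f0 0%N k).
    apply: le_trans; rewrite big_nat_recr//= leeDr//; apply: sume_ge0 => i _; exact: f0.
  rewrite m0E /f k1 expr0 mul1r lee_fin => ck.
  have -> : c k = 0 by apply/eqP; rewrite eq_le ck c0.
  by rewrite mulr0.
have m0_gt0 : 0 < fine (moment 0 c) by rewrite lt_neqAle eq_sym m0_neq0 fine_ge0.
split.
- by move=> k; rewrite /p; case: ifP => // k1; rewrite divr_ge0 ?c0// ltW.
- have -> : (\sum_(k <oo) (p k)%:E =
    \sum_(k <oo) ((fine (moment 0 c))^-1%:E * f 0%N k))%E.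
    apply: eq_eseriesr => k _; rewrite /p /f; case: ifP => _; last by rewrite mule0.
    by rewrite -EFinM expr0 mul1r mulrC.
  rewrite nneseriesZl; last by move=> k _; exact: f0.
  by rewrite -fE -{2}(fineK m0_fin) -EFinM mulVf.
- move=> k k2; have k1 : (1 <= k)%N by exact: ltnW.
  rewrite {1}/p k1; have := cE k k2; set m0 := fine _;
    set L := \sum_(1 <= i < k) _ => e.
  have -> : \sum_(1 <= i < k) p i * p (k - i)%N = L / m0 ^+ 2.
    rewrite /L mulr_suml !big_nat; apply: eq_bigr => i /andP[i1 ik].
    rewrite /p i1 subn_gt0 ik -/m0; field; exact: m0_neq0.
  have a0 : 2 + (k - 1)%N%:R / n%:R != 0 :> R by rewrite gt_eqF// ltr_pwDl// divr_ge0.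
  have -> : c k = m0^-1 * L / (2 + (k - 1)%N%:R / n%:R) by rewrite -e mulrC mulKf.
  rewrite /survival; move: a0; set a := 2 + _ => a0; field.
  by rewrite a0 m0_neq0.
Qed.

End mass_one_recursion.

(** * Measurability *)

Section countable_quantifiers.
Context (d : measure_display) (Omega : measurableType d).

Lemma measurable_exists (C : countType) (A : C -> set Omega) :
  (forall c, measurable (A c)) -> measurable [set w | exists c, A c w].
Proof.
move=> mA; rewrite (_ : [set w | _] = \bigcup_c A c).
  exact: countable_bigcupT_measurable.
by apply/seteqP; split => w [c]; [exists c|exists c].
Qed.

Lemma measurable_forall (C : countType) (A : C -> set Omega) :
  (forall c, measurable (A c)) -> measurable [set w | forall c, A c w].
Proof.
move=> mA; rewrite (_ : [set w | _] = ~` [set w | exists c, (~` A c) w]).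
  by apply: measurableC; apply: measurable_exists => c; exact: measurableC.
apply/seteqP; split => w /=; first by move=> H [c]; exact.
by move=> H c; apply: contrapT => nA; apply: H; exists c.
Qed.

Lemma measurable_prop (Q : Prop) : measurable [set _ : Omega | Q].
Proof.
have [q|nq] := pselect Q.
  by rewrite (_ : [set _ | Q] = setT)//; apply/seteqP; split.
by rewrite (_ : [set _ | Q] = set0)//; apply/seteqP; split.
Qed.

Lemma measurable_iff (A : set Omega) (Q : Prop) : measurable A ->
  measurable [set w | A w <-> Q].
Proof.
move=> mA; have [q|nq] := pselect Q.
  by rewrite (_ : [set w | _] = A)//; apply/seteqP; split => w /=; [case=> _; exact|].
rewrite (_ : [set w | _] = ~` A); first exact: measurableC.
by apply/seteqP; split => w /=; [case=> H _ /H|move=> nA; split].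
Qed.

Lemma card_eq_seqP (T : choiceType) (A : set T) k :
  (A #= `I_k)%card <-> exists s : seq T, [/\ uniq s, size s = k & A = [set` s]].
Proof.
split=> [Ak|[s [us <- ->]]].
  have fA : finite_set A by apply/finite_setP; exists k.
  exists (fset_set A); split; [exact: fset_uniq|exact: card_fset_set|].
  by rewrite fset_setK.
exact: card_eq_seq.
Qed.

Lemma measurable_set_eq (C : countType) (L : Omega -> set C) (T : set C) :
  (forall u, measurable [set w | L w u]) -> measurable [set w | L w = T].
Proof.
move=> mL; rewrite (_ : [set w | _] = [set w | forall u, L w u <-> T u]).
  by apply: measurable_forall => u; exact: (measurable_iff _ (mL u)).
apply/seteqP; split => w /=; first by move=> ->.
by move=> H; apply/funext => u; apply/propext.
Qed.

Lemma measurable_card_eq (C : countType) (L : Omega -> set C) k :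
  (forall u, measurable [set w | L w u]) ->
  measurable [set w | (L w #= `I_k)%card].
Proof.
move=> mL; rewrite (_ : [set w | _] =
    [set w | exists s : seq C, (uniq s /\ size s = k) /\ L w = [set` s]]).
  apply: measurable_exists => s; apply: measurableI; first exact: measurable_prop.
  exact: (measurable_set_eq _ mL).
apply/seteqP; split => w /=.
  by move=> /card_eq_seqP[s [? ? ?]]; exists s; split; [split|].
by move=> [s [[? ?] ?]]; apply/card_eq_seqP; exists s.
Qed.

(** On D the set Q depends on finitely many booleans only, so it is a union of cells of a finite
    partition; the induction splits D along one boolean at a time. *)
Lemma measurable_determined (I : eqType) (s : seq I) (b : I -> Omega -> bool)
    (D Q : set Omega) : measurable D ->
  (forall i, i \in s -> measurable (D `&` [set w | b i w])) ->
  (forall w w', D w -> D w' -> {in s, forall i, b i w = b i w'} -> Q w -> Q w') ->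
  measurable (D `&` Q).
Proof.
elim: s D => [|i s IH] D mD mb det.
  have [[w0 [Dw0 Qw0]]|nQ] := pselect (exists w, D w /\ Q w).
    rewrite (_ : D `&` Q = D)//; apply/seteqP; split => w; first by case.
    by move=> Dw; split => //; exact: det Dw0 Dw _ Qw0.
  rewrite (_ : D `&` Q = set0)//; apply/seteqP; split => // w [Dw Qw].
  by apply: nQ; exists w.
have mbi : measurable (D `&` [set w | b i w]) by apply: mb; exact: mem_head.
have mbj j : j \in s -> measurable (D `&` [set w | b j w]).
  by move=> js; apply: mb; rewrite in_cons js orbT.
have -> : D `&` Q = (D `&` [set w | b i w])
  `&` Q `|` (D `\` (D `&` [set w | b i w])) `&` Q.
  rewrite -setIUl; congr (_ `&` _); apply/seteqP; split => w /=.
    move=> Dw; case: (boolP (b i w)) => bi; first by left.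
    by right; split => // -[_]; exact/negP.
  by move=> [[]|[]].
apply: measurableU; apply: IH.
- exact: mbi.
- move=> j /mbj mj; rewrite (_ : _ `&` [set w | b j w] =
    (D `&` [set w | b i w]) `&` (D `&` [set w | b j w])); first exact: measurableI.
  by rewrite setIACA setIid setIA.
- move=> w w' [Dw bw] [Dw' bw'] H; apply: det => // j;
    rewrite in_cons => /predU1P[->|/H//].
  by rewrite bw bw'.
- exact: measurableD.
- move=> j /mbj mj; rewrite (_ : _ `&` [set w | b j w] =
    (D `&` [set w | b j w]) `\` (D `&` [set w | b i w])); first exact: measurableD.
  by apply/seteqP; split => w; [move=> [[Dw nb] bj]|move=> [[Dw bj] nb]].
- move=> w w' [Dw bw] [Dw' bw'] H; apply: det => // j;
    rewrite in_cons => /predU1P[->|/H//].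
  by apply/idP/idP => bi; [case: bw|case: bw'].
Qed.

End countable_quantifiers.

(** * Measurability of the order statistics of a process *)

Section order_statistics.
Context (R : realType).

Definition desc (s : seq R) : seq R := sort (fun a b : R => b <= a) s.

(** Counts of points say nothing about the order in which a process lists them, but they determine
    its points in decreasing order. *)
Definition order_stat (s : seq R) (j : nat) : R := nth 0 (desc s) j.

Lemma nth_desc_gt (l : seq R) j (t : R) : sorted (fun a b : R => b <= a) l ->
  (j < size l)%N -> (t < nth 0 l j) = (j < count (fun s => (t < s)%R) l)%N.
Proof.
have tr : transitive (fun a b : R => b <= a) by move=> y x z xy yz;
  exact: le_trans yz xy.
elim: l j => [|a l IH] // j sl; have sl' := path_sorted sl.
have al := order_path_min tr sl; rewrite /= ltnS.
case: (boolP (t < a)) => ta /=.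
  by case: j => [|j] jl; rewrite /= ?ta// IH// add1n.
have -> : count (fun s => (t < s)%R) l = 0%N.
  apply/eqP; rewrite -leqn0 leqNgt -has_count; apply/hasPn => s /(allP al) sa.
  by rewrite -leNgt (le_trans sa)// leNgt.
case: j => [|j] jl /=; first exact/negbTE.
apply/negbTE; rewrite -leNgt; have /(allP al) na : nth 0 l j \in l by exact: mem_nth.
by rewrite (le_trans na)// leNgt.
Qed.

Lemma order_stat_gt (s : seq R) j (t : R) : (j < size s)%N ->
  (t < order_stat s j) = (j < count (fun y => (t < y)%R) s)%N.
Proof.
move=> js; rewrite /order_stat nth_desc_gt; last 2 first.
- by apply: sort_sorted => a b; exact: le_total.
- by rewrite size_sort.
by congr (_ < _)%N; apply/permP; rewrite perm_sort.
Qed.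

Context (d : measure_display) (Omega : measurableType d) (pi : vertex ->
  Omega -> seq R).
Hypothesis mnb : forall (A : set R) (x : vertex) (m : nat), measurable A ->
  measurable [set w | nb_points pi A x w = m].

Lemma size_nb_points x w : size (pi x w) = nb_points pi setT x w.
Proof. by rewrite /nb_points; apply/esym/eqP; rewrite -all_count;
  apply/allP => s _; rewrite inE. Qed.

Lemma measurable_size x m : measurable [set w | size (pi x w) = m].
Proof. by under eq_set do rewrite size_nb_points; exact: mnb. Qed.

Lemma measurable_nb_points_gt A x j : measurable A ->
  measurable [set w | (j < nb_points pi A x w)%N].
Proof.
move=> mA; rewrite (_ : [set w | _] =
  [set w | exists m, (j < m)%N /\ nb_points pi A x w = m]).
  by apply: measurable_exists => m; apply: measurableI;
    [exact: measurable_prop|exact: mnb].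
by apply/seteqP; split => w /=; [move=> H; eexists; split;
  first exact: H|move=> [m [H ->]]].
Qed.

Lemma measurable_order_stat x j :
  measurable_fun setT (fun w => order_stat (pi x w) j).
Proof.
move=> mT; apply: (measurability _ (RGenOInfty.measurableE R)) => // _ [_ [t ->] <-].
have mjs : measurable [set w | (j < size (pi x w))%N].
  by under eq_set do rewrite size_nb_points; exact: measurable_nb_points_gt.
(* Past the last point [order_stat] takes its default value 0, hence the second piece. *)
rewrite setTI (_ : _ @^-1` _ =
  [set w | (j < nb_points pi `]t, +oo[%classic x w)%N] `|`
  [set w | ~ (j < size (pi x w))%N /\ t < 0]).
  apply: measurableU; first exact: measurable_nb_points_gt.
  apply: measurableI; last exact: measurable_prop.
  exact: (measurableC mjs).
have cE w : nb_points pi `]t, +oo[%classic x w = count (fun y => (t < y)%R) (pi x w).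
  by apply: eq_count => y; apply/idP/idP; rewrite inE/= in_itv/= andbT.
apply/seteqP; split => w /=; rewrite in_itv/= andbT cE.
  case: (ltnP j (size (pi x w))) => jx; first by rewrite order_stat_gt//; left.
  by rewrite /order_stat nth_default ?size_sort// => t0; right; split.
move=> [jc|[/negP jx t0]]; first by rewrite order_stat_gt// (leq_trans jc)// count_size.
by rewrite /order_stat nth_default// size_sort leqNgt.
Qed.

End order_statistics.

(** * The exploration is determined by finitely many comparisons *)

Section determination.
Context (R : realType).
Implicit Types (X : seq vertex) (M : seq (vertex * R)).

Let lower (a b : vertex * R) : bool := b.2 <= a.2.
Let before X (a b : vertex * R) : bool := (index a.1 X <= index b.1 X)%N.
(* A stable sort breaks ties in the order of the input, so the exploring order
   is the only ordering of the marks which is sorted for [lex]: it does not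
   depend on the order of the points within each process. *)
Let lex X (a b : vertex * R) : bool := lower a b && (lower b a ==> before X a b).

Let lower_total : total lower.
Proof. by move=> a b; exact: le_total. Qed.

Let before_trans X : transitive (before X).
Proof. by move=> b a c; exact: leq_trans. Qed.

Let lex_trans X : transitive (lex X).
Proof.
move=> b a c /andP[ab ab'] /andP[bc bc']; apply/andP; split.
  exact: le_trans bc ab.
apply/implyP => ca; apply: (@leq_trans (index b.1 X)).
  by apply: (implyP ab'); exact: le_trans ca bc.
by apply: (implyP bc'); exact: le_trans ab ca.
Qed.

Lemma sorted_lex_inj X M M' : (forall m, m \in M -> m.1 \in X) ->
  sorted (lex X) M -> sorted (lex X) M' -> perm_eq M M' -> M = M'.
Proof.
move=> MX sM sM' pM; apply: sorted_eq_in sM sM' pM.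
  by move=> a b c _ _ _; exact: lex_trans.
move=> [x s] [y t] xM yM /andP[/andP[h1 h2] /andP[h3 h4]].
have st : s = t by apply/eqP; rewrite eq_le; apply/andP; split; [exact: h3|exact: h1].
have xy : x = y.
  apply: (@index_inj _ [::] X); rewrite ?inE; [exact: MX xM|exact: MX yM|].
  by apply/eqP; rewrite eqn_leq; apply/andP; split;
    [exact: (implyP h2)|exact: (implyP h4)].
by rewrite st xy.
Qed.

Lemma sorted_before_allpairs (T : eqType) X (f : vertex -> T -> vertex * R)
    (p : vertex -> seq T) : uniq X -> (forall x s, (f x s).1 = x) ->
  sorted (before X) [seq f x s | x <- X, s <- p x].
Proof.
move=> uX f1; rewrite sorted_pairwise; last exact: before_trans.
have pX : pairwise (fun x y => index x X <= index y X)%N X.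
  apply/(pairwiseP [::]) => i j; rewrite !inE => iX jX ij.
  by rewrite !index_uniq// ltnW.
suff H Y : pairwise (fun x y => index x X <= index y X)%N Y ->
  pairwise (before X) [seq f x s | x <- Y, s <- p x] by exact: H.
elim: Y => //= x X' IH /andP[/allP xX' pX']; rewrite pairwise_cat IH// andbT.
apply/andP; split.
  apply/allrelP => a b /mapP[s _ ->] /allpairsPdep[y [t [yX' _ ->]]].
  by rewrite /before !f1; exact: xX'.
elim: (p x) => //= s l ->; rewrite andbT; apply/allP => b /mapP[t _ ->].
by rewrite /before !f1.
Qed.

(** Names for the marks that depend on the numbers of points only, so that explorations of different
    outcomes can be compared. *)
Definition mark_ids X (N : vertex -> nat) : seq (vertex * nat) :=
  [seq (x, j) | x <- X, j <- iota 0 (N x)].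

Definition place (pi : vertex -> seq R) (a : vertex * nat) : vertex * R :=
  (a.1, order_stat (pi a.1) a.2).

Lemma perm_place X pi :
  perm_eq [seq place pi a | a <- mark_ids X (fun x => size (pi x))]
          [seq (x, s) | x <- X, s <- pi x].
Proof.
rewrite /mark_ids map_allpairs/=.
have := @allpairs_mapr vertex (fun=> R) (fun=> nat) _ (fun x s => (x, s))
  (fun x => order_stat (pi x)) X (fun x => iota 0 (size (pi x))).
rewrite /place /= => <-.
apply: perm_allpairs_dep => // x _.
have -> : [seq order_stat (pi x) j | j <- iota 0 (size (pi x))] = desc (pi x).
  by rewrite -(size_sort (fun a b : R => b <= a)) -[RHS](mkseq_nth 0).
by rewrite perm_sort.
Qed.

(** Two outcomes with the same comparisons explore the same names in the same order, namely the list
    l got by sorting the names; ties are settled by [lex]. *)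
Lemma sort_marks_transfer X pi pi' : uniq X ->
  {in X, forall x, size (pi x) = size (pi' x)} ->
  (let ids := mark_ids X (fun x => size (pi x)) in
   {in ids &, forall a b, ((place pi b).2 <= (place pi a).2) =
                          ((place pi' b).2 <= (place pi' a).2)}) ->
  exists2 l, {subset l <= mark_ids X (fun x => size (pi x))} &
    sort lower [seq (x, s) | x <- X, s <- pi x] = [seq place pi a | a <- l] /\
    sort lower [seq (x, s) | x <- X, s <- pi' x] = [seq place pi' a | a <- l].
Proof.
move=> uX sz cmp; set ids := mark_ids X _.
have idsE : ids = mark_ids X (fun x => size (pi' x)).
  rewrite /ids /mark_ids; congr flatten; apply/eq_in_map => x xX.
  by rewrite sz.
have ids_sorted p : sorted (before X) [seq place p a | a <- ids].
  by rewrite /ids /mark_ids map_allpairs; exact: sorted_before_allpairs.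
have marks_sorted p : sorted (before X) [seq (x, s) | x <- X, s <- (p x : seq R)].
  exact: sorted_before_allpairs.
have marksX p m : m \in [seq (x, s) | x <- X, s <- (p x : seq R)] -> m.1 \in X.
  by move=> /allpairsPdep[x [s [xX _ ->]]].
pose l := sort (relpre (place pi) lower) ids.
have lE : [seq place pi a | a <- l] = sort lower [seq place pi a | a <- ids].
  by rewrite sort_map.
have sl : sorted (lex X) [seq place pi a | a <- l].
  by rewrite lE; apply: sort_stable => //; exact: before_trans.
have lids : {subset l <= ids} by move=> a; rewrite mem_sort.
exists l => //; split.
  apply: (@sorted_lex_inj X).
  - by move=> m; rewrite mem_sort; exact: marksX.
  - by apply: sort_stable => //; exact: before_trans.
  - exact: sl.
  - by rewrite perm_sort lE perm_sym perm_sort; exact: perm_place.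
apply: (@sorted_lex_inj X).
- by move=> m; rewrite mem_sort; exact: marksX.
- by apply: sort_stable => //; exact: before_trans.
- move: sl; rewrite !sorted_map; apply: sub_in_sorted; last exact/allP/lids.
  move=> a b aids bids; rewrite /lex /lower /=.
  by rewrite !(cmp _ _ aids bids) !(cmp _ _ bids aids).
- rewrite perm_sort perm_sym.
  apply: (@perm_trans _ [seq place pi' a | a <- ids]).
    by apply: perm_map; rewrite perm_sort.
  by rewrite idsE; exact: perm_place.
Qed.

(** The exploration uses a mark only through its rank, its node and its edge, and the edge is found
    by comparing the mark with heights along the branch. *)
Lemma pruned_determined kappa kappa' pi pi' (T : set vertex) :
  let X := fset_set (internal T) in
  {in X, forall x, size (pi x) = size (pi' x)} ->
  (let ids := mark_ids X (fun x => size (pi x)) in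
   {in ids &, forall a b, ((place pi b).2 <= (place pi a).2) =
                          ((place pi' b).2 <= (place pi' a).2)} /\
   {in ids, forall a i, (i < (size a.1).+1)%N ->
     ((place pi a).2 <= height kappa (take i a.1)) =
     ((place pi' a).2 <= height kappa' (take i a.1))}) ->
  pruned kappa pi T = pruned kappa' pi' T.
Proof.
move=> X sz /= [cmp hgt]; rewrite /pruned /marks.
have [l lids [-> ->]] := sort_marks_transfer (fset_uniq X) sz cmp.
have edgeE a : a \in l ->
    edge_at kappa a.1 (place pi a).2 = edge_at kappa' a.1 (place pi' a).2.
  move=> al; rewrite /edge_at; congr (take _ _); apply: eq_in_find => i.
  by rewrite mem_iota => /andP[_ ia]; apply: hgt ia; exact: lids.
clear - edgeE; elim: l T edgeE => //= a l IH T edgeE.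
rewrite [explore_mark kappa' _ _](_ : _ = explore_mark kappa T (place pi a)).
  by apply: IH => b bl; apply: edgeE; rewrite in_cons bl orbT.
by rewrite /explore_mark/= (edgeE a)// mem_head.
Qed.

End determination.

Section pruned_measurable.
Context (d : measure_display) (Omega : measurableType d) (R : realType).
Variables (P : probability Omega R) (G : Omega -> set vertex).
Variables (kappa : vertex -> {RV P >-> R}) (pi : vertex -> Omega -> seq R).
Hypothesis mnb : forall (A : set R) (x : vertex) (m : nat), measurable A ->
  measurable [set w | nb_points pi A x w = m].
Hypothesis mG : forall u, measurable [set w | G w u].

Let measurable_height x : measurable_fun setT (fun w => height (kappa ^~ w) x).
Proof. by apply: measurable_sum => i; exact: (measurable_funPT (kappa _)). Qed.

Let sizes (X : seq vertex) (w : Omega) : seq nat := [seq size (pi x w) | x <- X].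

Let measurable_sizes X z : measurable [set w | sizes X w = z].
Proof.
elim: X z => [|x X IH] [|k z].
- by rewrite [X in measurable X](_ : _ = setT)//; apply/seteqP.
- by rewrite [X in measurable X](_ : _ = set0)//; apply/seteqP; split.
- by rewrite [X in measurable X](_ : _ = set0)//; apply/seteqP; split.
- rewrite [X in measurable X](_ : _ =
      [set w | size (pi x w) = k] `&` [set w | sizes X w = z]).
    by apply: measurableI => //; exact: (measurable_size mnb).
  by apply/seteqP; split => w /=; [case|move=> [-> ->]].
Qed.

(* For given numbers of points, the pruned tree only depends on finitely many
   comparisons between order statistics and heights. *)
Lemma measurable_pruned_finite (T : set vertex) (Q : set vertex -> Prop) :
  measurable [set w | G w = T /\ Q (pruned (kappa ^~ w) (pi ^~ w) (G w))].
Proof.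
pose X : seq vertex := fset_set (internal T).
rewrite (_ : [set w | _] = [set w | exists z : seq nat,
    (G w = T /\ sizes X w = z) /\ Q (pruned (kappa ^~ w) (pi ^~ w) (G w))]); last first.
  by apply/seteqP; split => w /= [H1 H2]; [exists (sizes X w)|case: H2 => [[]]].
apply: measurable_exists => z.
have mD : measurable [set w | G w = T /\ sizes X w = z].
  by apply: measurableI; [exact: (measurable_set_eq T mG)|exact: measurable_sizes].
pose N x := nth 0%N z (index x X).
pose ids := mark_ids X N.
have szE w : sizes X w = z -> {in X, forall x, size (pi x w) = N x}.
  by move=> zw x xX; rewrite /N -zw (nth_map [::]) ?index_mem// nth_index.
pose b (i : ((vertex * nat) * (vertex * nat)) + ((vertex * nat) * nat)) w : bool :=
  match i with
  | inl (a, a') => (place (pi ^~ w) a').2 <= (place (pi ^~ w) a).2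
  | inr (a, j) => (place (pi ^~ w) a).2 <= height (kappa ^~ w) (take j a.1)
  end.
pose s := [seq inl (a, a') | a <- ids, a' <- ids] ++
  [seq inr (a, j) | a <- ids, j <- iota 0 (size a.1).+1].
have mplace a : measurable_fun setT (fun w => (place (pi ^~ w) a).2).
  exact: measurable_order_stat.
apply: (@measurable_determined _ _ _ s b) => //.
- move=> [[a a']|[a j]] _ /=; apply: measurableI => //.
    rewrite -[X in measurable X]setTI; apply: measurable_fun_le => //; exact: mplace.
  rewrite -[X in measurable X]setTI; apply: measurable_fun_le => //.
    exact: mplace.
- move=> w w' [Gw zw] [Gw' zw'] bE; rewrite Gw Gw'.
  suff -> : pruned (kappa ^~ w) (pi ^~ w) T = pruned (kappa ^~ w') (pi ^~ w') T by [].
  have idsE : mark_ids X (fun x => size (pi x w)) = ids.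
    rewrite /ids /mark_ids; congr flatten; apply/eq_in_map => x xX.
    by rewrite (szE w zw).
  apply: pruned_determined => [x xX|]; first by rewrite (szE w zw)// (szE w' zw').
  rewrite -/X idsE; split=> [a a' aI aI'|a aI j ja].
    apply: (bE (inl (a, a'))); rewrite mem_cat; apply/orP; left.
    exact: allpairs_f.
  apply: (bE (inr (a, j))); rewrite mem_cat; apply/orP; right.
  apply/allpairsPdep; exists a, j; split => //; by rewrite mem_iota.
Qed.

Hypothesis tree_finite_internal : forall w,
  finite_set (internal (G w)) -> finite_set (G w).

(** There are countably many finite trees. If G is infinite, so is its set of internal nodes, whose
    [fset_set] is then empty: there are no marks to explore and [pruned] returns G. *)
Lemma measurable_pruned (Q : set vertex -> Prop) :
  measurable [set w | Q (G w)] ->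
  measurable [set w | Q (pruned (kappa ^~ w) (pi ^~ w) (G w))].
Proof.
move=> mQ; have mfin : measurable [set w | finite_set (G w)].
  rewrite (_ : [set w | _] = [set w | exists k, (G w #= `I_k)%card]).
    by apply: measurable_exists => k; exact: measurable_card_eq.
  by apply/seteqP; split => w /=; rewrite finite_setP.
rewrite (_ : [set w | _] =
  ([set w | Q (G w)] `\` [set w | finite_set (G w)]) `|`
  [set w | exists s : seq vertex, G w = [set` s] /\
     Q (pruned (kappa ^~ w) (pi ^~ w) (G w))]).
  apply: measurableU; first exact: measurableD.
  by apply: measurable_exists => s; exact: measurable_pruned_finite.
have inf w : ~ finite_set (G w) -> pruned (kappa ^~ w) (pi ^~ w) (G w) = G w.
  move=> nfin; rewrite /pruned /marks /fset_set.
  by case: pselect => // fin; case: nfin; exact: tree_finite_internal.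
apply/seteqP; split => w /=.
  move=> Qw; have [fin|nfin] := pselect (finite_set (G w)).
    by right; have /finite_seqP[s sE] := fin; exists s.
  by left; split => //; rewrite -inf.
by move=> [[Qw nfin]|[s []//]]; rewrite inf.
Qed.

End pruned_measurable.

(** * The leaf laws *)

Lemma gw_tree_finite_internal off :
  finite_set (internal (gw_tree off)) -> finite_set (gw_tree off).
Proof.
move=> fI; apply: (@sub_finite_set _ _ ([set [::]] `|`
  \bigcup_(v in internal (gw_tree off)) [set rcons v i | i in `I_(off v)])).
  move=> u; case/lastP: u => [|v i] Gu; [by left|right].
  have [Gv iv] := (gw_tree_rcons off v i).1 Gu.
  by exists v; [split => //; exists i|exists i].
rewrite finite_setU; split; first exact: finite_set1.
by apply: bigcup_finite => // v _; apply: finite_image; exact: finite_II.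
Qed.

Lemma prob_full_measure (d : measure_display) (T : measurableType d) (R : realType)
    (P : probability T R) (A B : set T) :
  measurable A -> measurable B -> P B = 1%E -> P (A `&` B) = P A.
Proof.
move=> mA mB PB; apply: measure_setI_negligible => //; first exact: measurableI.
apply: (@negligibleS _ _ _ _ (~` B)); first by move=> w [].
apply/negligibleP; first exact: measurableC.
by have := probability_setC P mB; rewrite PB subee.
Qed.

Section leaf_laws.
Context (d : measure_display) (Omega : measurableType d) (R : realType).
Variables (P : probability Omega R) (xi : vertex -> {RV P >-> nat}).
Hypothesis xi_iid : iid_offspring (@critical_binary R) xi.

Let G := fun w : Omega => gw_tree (fun v => xi v w).

Let mG t : measurable (tree_event G (tset t)) := measurable_tree_event xi t.

Lemma measurable_gw_tree u : measurable [set w | G w u].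
Proof.
rewrite (_ : [set w | _] = [set w | forall vi : seq nat * nat,
    prefix (rcons vi.1 vi.2) u -> (vi.2 < xi vi.1 w)%N]).
  apply: measurable_forall => -[v i] /=.
  case: (prefix _ u); last first.
    by rewrite [X in measurable X](_ : _ = setT)//; apply/seteqP.
  rewrite [X in measurable X](_ : _ = xi v @^-1` [set k | (i < k)%N]).
    exact: measurable_funPTI.
  by apply/seteqP; split => w /=; [exact|].
by apply/seteqP; split => w; [move=> H [v i]; exact: H|move=> H v i; exact: (H (v, i))].
Qed.

Lemma measurable_leaves u : measurable [set w | leaves (G w) u].
Proof.
apply: measurableI; first exact: measurable_gw_tree.
apply: (measurableC (A := [set w | exists i, G w (rcons u i)])).
by apply: measurable_exists => i; exact: measurable_gw_tree.
Qed.

Lemma prob_leaves_gw k : (1 <= k)%N ->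
  P [set w | (leaves (G w) #= `I_k)%card] =
  (2 / (4 ^+ k * k%:R) * 'C(2 * k - 2, k - 1)%:R)%:E.
Proof.
pose D t k : set Omega := if nleaves t == k then tree_event G (tset t) else set0.
pose F k : set Omega := [set w | exists t, D t k w].
have mD t j : measurable (D t j).
  by rewrite /D; case: ifP => _; [exact: mG|exact: measurable0].
have DT t j : D t j `<=` tree_event G (tset t).
  by rewrite /D; case: ifP => _ w //; case.
have PD t j : P (D t j) = (tree_weight R t * (nleaves t == j)%:R)%:E.
  rewrite /D; case: ifP => _; last by rewrite mulr0 measure0.
  by rewrite mulr1 (prob_tree_event xi_iid).
have [mfin Pfin] := prob_finite_tree xi_iid.
have mF j : measurable (F j) by have []
  := prob_exists_tree (mD ^~ j) (DT ^~ j) (PD ^~ j).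
have PE j : P [set w | (leaves (G w) #= `I_j)%card] = P (F j).
  rewrite -(prob_full_measure (measurable_card_eq j measurable_leaves) mfin Pfin).
  congr (P _); apply/seteqP; split => w.
    move=> [/= Lj [t Tw]]; exists t; rewrite /D ifT//.
    by apply/eqP; apply/leaves_tset; rewrite -Tw.
  move=> [t]; rewrite /D; case: eqP => // tj Tw; split; last by exists t.
  by rewrite /= Tw; apply/leaves_tset.
move=> k1; rewrite PE -(fineK (fin_num_measure P _ (mF k))); congr EFin.
apply: (catalan_recursion (q := fun j => fine (P (F j)))) => //.
  have -> : F 1%N = tree_event G (tset Lf).
    apply/seteqP; split => w; last by exists Lf.
    move=> [[|l r]]; rewrite /D //=; case: eqP => //.
    by have := nleaves_gt0 l; have := nleaves_gt0 r; lia.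
  by rewrite prob_tree_event.
move=> j j2; have := @prob_recursion _ _ _ P xi D (fun t j =>
  (nleaves t == j)%:R) (fun=> 1) mD DT PD.
rewrite /= div1r; apply => //.
  by move=> i i2; case: eqP => // i1; rewrite -i1 in i2.
move=> l r i _; rewrite mul1r.
(* With one-element families the convolution formula says that the indicator of a + b = i is the sum
   over m of the products of the indicators of a = m and b = i - m. *)
have := @sum_convolution R unit unit [:: tt] [:: tt] (fun=> nleaves l) (fun=> nleaves r)
  (fun=> 1) (fun=> 1) i (fun=> nleaves_gt0 l) (fun=> nleaves_gt0 r).
rewrite !big_seq1 mulr1 => e;
  transitivity (if (nleaves l + nleaves r)%N == i then 1 else 0 : R).
  by case: eqP.
rewrite -e; apply: eq_bigr => m _; rewrite !big_cons !big_nil !addr0.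
by case: (nleaves l == m); case: (nleaves r == _).
Qed.

(** On the almost sure event [reg] the leaf count is that of [rprune], so its law follows
    [prob_recursion]; the normalised solution c follows the same recursion and has the same mass. *)
Lemma prob_leaves_pruned n (kappa : vertex -> {RV P >-> R})
    (pi : vertex -> Omega -> seq R) (c : nat -> R) k :
  pruning_randomness n G kappa pi -> solves_E n c -> (1 <= k)%N ->
  P [set w | (leaves (pruned (fun e => kappa e w) (fun x =>
    pi x w) (G w)) #= `I_k)%card] =
  (c k / fine (moment 0 c))%:E.
Proof.
move=> prG cE k1.
pose hit w := unhit (kappa ^~ w) (pi ^~ w).
pose D t j : set Omega := regular G kappa pi t `&`
  [set w | nleaves (rprune t (hit w)) = j].
pose F j : set Omega := [set w | exists t, D t j w].
pose reg : set Omega := [set w | exists t, regular G kappa pi t w].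
have mD t j : measurable (D t j) by have [] := prob_leaf_count prG mG t j.
have DT t j : D t j `<=` tree_event G (tset t) by move=> w [[]].
have PD t j : P (D t j) = (tree_weight R t * leaf_prob R n t j)%:E.
  by have [_ ->] := prob_leaf_count prG mG t j; rewrite prob_tree_event.
have mF j : measurable (F j) by have []
  := prob_exists_tree (mD ^~ j) (DT ^~ j) (PD ^~ j).
have Pregt t : P (regular G kappa pi t) = (tree_weight R t)%:E.
  by rewrite (prob_regular prG mG) prob_tree_event.
have [mreg creg] := prob_exists_tree (measurable_regular prG mG)
  (fun t w => @proj1 _ _) Pregt.
have [mfin cfin] := prob_exists_tree mG (fun t w => id) (prob_tree_event xi_iid).
(* Both probabilities are limits of the same sums of [tree_weight], since each [regular] event has
   the probability of its tree. *)
have Preg : P reg = 1%E.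
  have [_ Pfin] := prob_finite_tree xi_iid.
  rewrite -(fineK (fin_num_measure P _ mreg)) -Pfin -(fineK (fin_num_measure P _ mfin)).
  by rewrite -(cvg_lim _ creg)// -(cvg_lim _ cfin).
have tfi w : finite_set (internal (G w)) -> finite_set (G w).
  exact: gw_tree_finite_internal.
pose E j := [set w | (leaves (pruned (kappa ^~ w) (pi ^~ w) (G w)) #= `I_j)%card].
have mE j : measurable (E j).
  apply: (@measurable_pruned _ _ _ P G kappa pi (nb_points_measurable prG)
    measurable_gw_tree tfi (fun T => (leaves T #= `I_j)%card)).
  exact: (measurable_card_eq j measurable_leaves).
have prunedE t w : regular G kappa pi t w ->
    pruned (kappa ^~ w) (pi ^~ w) (G w) = tset (rprune t (hit w)).
  by move=> [Tw [k0 p0]]; rewrite Tw; exact: pruned_tset.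
have PE j : P (E j) = P (F j).
  rewrite -(prob_full_measure (mE j) mreg Preg); congr (P _); apply/seteqP; split => w.
    move=> [Ew [t rw]]; exists t; split => //; apply/leaves_tset.
    by move: Ew; rewrite /E/= (prunedE _ _ rw).
  move=> [t [rw lw]]; split; last by exists t.
  by rewrite /E/= (prunedE _ _ rw); apply/leaves_tset.
rewrite [LHS](PE k) -(fineK (fin_num_measure P _ (mF k))); congr EFin.
pose q j := fine (P (F j)).
have [p0 psum pE] := solves_E_normalized cE.
pose p j := if (1 <= j)%N then c j / fine (moment 0 c) else 0.
suff : p k = q k by rewrite /p k1 => ->.
apply: (@mass_one_recursion_unique R (fun j => survival R n (j - 1) / 2) _ p q) => //.
- by move=> j; rewrite divr_ge0// survival_ge0.
- by move=> j; rewrite fine_ge0.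
- rewrite /q (_ : F 0%N = set0) ?measure0//; apply/seteqP; split => // w [t [_ /= H]].
  by have := nleaves_gt0 (rprune t (hit w)); rewrite H.
- move=> j j2; apply: (@prob_recursion _ _ _ P xi D (leaf_prob R n) (fun i =>
    survival R n (i - 1)) mD DT PD) => //.
  + exact: leaf_prob_Lf.
  + exact: leaf_prob_Nd.
(* The mass of q is 1 because on [reg] the pruned tree is finite and has exactly one number of
   leaves. *)
- have -> : (\sum_(j <oo) (q j)%:E = \sum_(j <oo) P (F j))%E.
    by apply: eq_eseriesr => j _; rewrite /q fineK// fin_num_measure.
  have FU : \bigcup_j F j = reg.
    apply/seteqP; split => w; first by move=> [j _ [t [rw _]]]; exists t.
    by move=> [t rw]; exists (nleaves (rprune t (hit w))) => //; exists t.
  rewrite -Preg -FU measure_semi_bigcup//; last by rewrite FU.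
  apply/trivIsetP => i j _ _ ij; rewrite -subset0 => w [[t [rt ti]] [t' [rt' tj]]].
  have tt' : t = t' by apply: tset_inj; rewrite -(DT t i w)// -(DT t' j w).
  by move: ij; rewrite -ti -tj tt' eqxx.
Qed.

End leaf_laws.

Theorem proposition15 (d : measure_display) (Omega : measurableType d)
    (R : realType) (P : probability Omega R) (n : nat) (n_ge1 : (1 <= n)%N)
    (xi : vertex -> {RV P >-> nat})
    (xi_iid : iid_offspring (@critical_binary R) xi) :
  let G := fun w : Omega => gw_tree (fun v => xi v w) in
  (forall k : nat, (1 <= k)%N ->
    P [set w | (leaves (G w) #= `I_k)%card] =
    (2 / (4 ^+ k * k%:R) * 'C(2 * k - 2, k - 1)%:R)%:E) /\
  (forall (kappa : vertex -> {RV P >-> R}) (pi : vertex -> Omega -> seq R),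
    pruning_randomness n G kappa pi ->
    forall c : nat -> R, solves_E n c ->
    forall k : nat, (1 <= k)%N ->
    P [set w | (leaves (pruned (fun e => kappa e w) (fun x => pi x w) (G w))
                #= `I_k)%card] =
    (c k / fine (moment 0 c))%:E).
Proof.
split=> [k k1|kappa pi prG c cE k k1]; first exact: prob_leaves_gw.
exact: prob_leaves_pruned prG cE k1.
Qed.
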